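(* Consider the following setting. Let $p$ be a target density on $\mathbb{R}^d$ with score $s_p=\nabla\log p$, and $k$ a continuous positive semi-definite kernel on $\mathbb{R}^d$. Let $q(z)$ be a mixing distribution on $\mathbb{R}^{d_z}$ and $q_\phi(x|z)=\mathcal{N}(\mu(z;\phi),\mathrm{diag}\{\sigma^2(z;\phi)\})$ with $\mu(z;\phi),\sigma(z;\phi)\in\mathbb{R}^d$, i.e. $x=\mu(z;\phi)+\sigma(z;\phi)\odot\xi$ with $\xi\sim\mathcal{N}(0,I_d)$, and $q_\phi(x)=\int q_\phi(x|z)q(z)\mathrm{d}z$. Define $$\mathcal{L}(\phi)=\mathbb{E}\Big[k(x,x')\big(s_p(x)+\xi/\sigma(z;\phi)\big)^\top\big(s_p(x')+\xi'/\sigma(z';\phi)\big)\Big],$$ where $(z,\xi),(z',\xi')$ are i.i.d. copies, $x=\mu(z;\phi)+\sigma(z;\phi)\odot\xi$, $x'=\mu(z';\phi)+\sigma(z';\phi)\odot\xi'$ (this equals $\mathrm{KSD}(q_\phi\|p)^2$). Assume: (A1) there is $B$ with $\max\{k,\|\nabla_1k\|,\|\nabla_{11}k\|,\|\nabla_{12}k\|\}\le B^2$ everywhere; (A2) $\log p$ is three times continuously differentiable with $\|\nabla^2\log p(x)\|\le L$, $\|\nabla^3\log p(x)\|\le M$ for all $x$; (A3) there is $G\ge1$ with $\max\{\|\nabla_\phi\mu(z;\phi)\|,\|\nabla_\phi^2\mu(z;\phi)\|\}\le G(1+\|z\|)$ and the same for $\sigma(z;\phi)$, and every entry of $\sigma(z;\phi)$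 is at least $1/\sqrt{L}$ for all $z,\phi$; (A4) $\mathbb{E}_{q(z)}\|z\|^4\lesssim d_z^2$ and $\mathbb{E}_{q_\phi(x)}\|x\|^4\le s^4$ for all $\phi$. Let $C$ be such that $C^2:=c_0\big[L^4(s^4+\|x^*\|^4)+\|s_p(x^* )\|^4\big]$ for some reference point $x^*\in\mathbb{R}^d$ and absolute constant $c_0$ (so that $\mathbb{E}_{q_\phi}\|s_p(x)\|^4\le C^2$). Then $\mathcal{L}$ is $L_\phi$-smooth (its gradient is $L_\phi$-Lipschitz in $\phi$), where $$L_\phi\lesssim B^2G^2d_z\log d\,\big[(1\vee L)^3+Ld+M^2+C\big].$$
   Context: $\nabla_1k,\nabla_2k$ denote gradients of $k$ w.r.t. its first/second argument, $\nabla_{11}k,\nabla_{12}k$ the corresponding second derivatives. $\odot$ and $\xi/\sigma$ are entrywise product and division. $\|\cdot\|$ is the Euclidean norm for vectors and the operator norm for matrices/tensors. $a\vee b=\max\{a,b\}$. $A\lesssim B$ means $A\le cB$ for an absolute constant $c$.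
   Formalization: The formal theorem assumes d ≥ 2 and d_z ≥ 1: for d = 1 the factor log d (and for d_z = 0 the factor d_z) makes the stated bound 0, which fails e.g. for a one-dimensional Gaussian target with μ = sin φ, σ = 1. *)

(* Defs.v *)
From HB Require Import structures.
From mathcomp Require Import all_boot all_order all_algebra.
From mathcomp Require Import all_classical all_reals all_analysis.
Set Implicit Arguments. Unset Strict Implicit. Unset Printing Implicit Defensive.
Import Order.TTheory GRing.Theory Num.Theory.
Import numFieldNormedType.Exports.
Local Open Scope classical_set_scope.
Local Open Scope ring_scope.

Section Defs.
Context {R : realType}.

Definition evec n (i : 'I_n) : 'rV[R]_n := delta_mx 0 i.
Definition dotv n (u v : 'rV[R]_n) : R := \sum_(i < n) u 0 i * v 0 i.
Definition enorm n (v : 'rV[R]_n) : R := Num.sqrt (dotv v v).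
Definition grad n (f : 'rV[R]_n -> R) (x : 'rV[R]_n) : 'rV[R]_n :=
  \row_i ('D_(evec i) f x).
Definition hadam n (u v : 'rV[R]_n) : 'rV[R]_n := \row_i (u 0 i * v 0 i).
Definition ediv n (u v : 'rV[R]_n) : 'rV[R]_n := \row_i (u 0 i / v 0 i).

Definition C3 n (f : 'rV[R]_n -> R) : Prop :=
  (forall x, differentiable f x) /\
  (forall w x, differentiable ('D_w f) x) /\
  (forall v w x, differentiable ('D_v ('D_w f)) x) /\
  (forall u v w, continuous ('D_u ('D_v ('D_w f)))).

Definition cont_psd_kernel n (k : 'rV[R]_n -> 'rV[R]_n -> R) : Prop :=
  continuous (fun xy : 'rV[R]_n * 'rV[R]_n => k xy.1 xy.2) /\
  (forall x y, k x y = k y x) /\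
  (forall (N : nat) (xs : 'I_N -> 'rV[R]_n) (c : 'I_N -> R),
      0 <= \sum_(i < N) \sum_(j < N) c i * c j * k (xs i) (xs j)).

Definition xsample dz d m (mu sigma : 'rV[R]_dz -> 'rV[R]_m -> 'rV[R]_d)
  (phi : 'rV[R]_m) (z : 'rV[R]_dz) (xi : 'rV[R]_d) : 'rV[R]_d :=
  mu z phi + hadam (sigma z phi) xi.

(* the KSD objective L(phi): expectation over two i.i.d. copies (z,xi),(z',xi'),
   realised as the product P \x P of the underlying probability space *)
Definition ksd_loss dO (Omega : measurableType dO) (P : probability Omega R)
  dz d m (z : Omega -> 'rV[R]_dz) (xi : Omega -> 'rV[R]_d)
  (k : 'rV[R]_d -> 'rV[R]_d -> R) (sp : 'rV[R]_d -> 'rV[R]_d)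
  (mu sigma : 'rV[R]_dz -> 'rV[R]_m -> 'rV[R]_d) (phi : 'rV[R]_m) : R :=
  \int[(P \x P)%E]_(w in [set: Omega * Omega])
    (let x  := xsample mu sigma phi (z w.1) (xi w.1) in
     let x' := xsample mu sigma phi (z w.2) (xi w.2) in
     k x x' * dotv (sp x  + ediv (xi w.1) (sigma (z w.1) phi))
                   (sp x' + ediv (xi w.2) (sigma (z w.2) phi))).

End Defs.

(* Main.v *)
Require Import Defs.
From HB Require Import structures.
From mathcomp Require Import all_boot all_order all_algebra.
From mathcomp Require Import all_classical all_reals all_analysis.
From mathcomp Require Import measurable_realfun ring lra.
Import Order.TTheory GRing.Theory Num.Theory.
Import numFieldNormedType.Exports.
Local Open Scope classical_set_scope.
Local Open Scope ring_scope.

Set Implicit Arguments.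
Unset Strict Implicit.

(** Write the random integrand as [h(phi) = k(x, x') <F, F'>] with
    [F = s_p(x) + xi/sigma].  Up to a factor depending on [L] and [M] only, the
    Lipschitz constants and the second-order Taylor remainders of [phi |-> x]
    and [phi |-> F] are bounded by [A] and [A^2], where
    [A = G (1 + |z|) (1 + max_i |xi_i|)].  Hence, for every outcome,
    [|h(psi) - h(phi) - Dh(phi)(psi - phi)| <= Lam |psi - phi|^2], where [Lam]
    is [B^2 (A + A')^2] times a quadratic polynomial in the values of [|F|] and
    [|F'|] at [phi] and [psi].

    By Cauchy-Schwarz the mean of [Lam] is controlled by [E A^4] and [E |F|^4].
    The first is [O((G^2 dz ln d)^2)], because [z] and [xi] are independent and
    [E exp(3 xi_i^2 / 8) = 2]; the second is [O((C + L d)^2)], because [s_p] is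
    [L]-Lipschitz.  Finally, a function that is approximated at every point by
    a linear form with remainder at most [Q |v|^2] has a [6Q]-Lipschitz
    gradient, so the loss is never differentiated twice. *)

(** * Euclidean norm *)

Section Euclidean.
Context {R : realType}.
Implicit Types (n : nat) (a c : R).

Lemma dotvC n (u v : 'rV[R]_n) : dotv u v = dotv v u.
Proof. by apply: eq_bigr => i _; rewrite mulrC. Qed.

Lemma dotvDl n (u v w : 'rV[R]_n) : dotv (u + v) w = dotv u w + dotv v w.
Proof. by rewrite -big_split; apply: eq_bigr => i _; rewrite mxE mulrDl. Qed.

Lemma dotvDr n (u v w : 'rV[R]_n) : dotv w (u + v) = dotv w u + dotv w v.
Proof. by rewrite dotvC dotvDl !(dotvC _ w). Qed.

Lemma dotvZl n a (u v : 'rV[R]_n) : dotv (a *: u) v = a * dotv u v.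
Proof. by rewrite mulr_sumr; apply: eq_bigr => i _; rewrite mxE mulrA. Qed.

Lemma dotvZr n a (u v : 'rV[R]_n) : dotv u (a *: v) = a * dotv u v.
Proof. by rewrite dotvC dotvZl dotvC. Qed.

Lemma dotvBl n (u v w : 'rV[R]_n) : dotv (u - v) w = dotv u w - dotv v w.
Proof. by rewrite dotvDl -scaleN1r dotvZl mulN1r. Qed.

Lemma dotvBr n (u v w : 'rV[R]_n) : dotv w (u - v) = dotv w u - dotv w v.
Proof. by rewrite dotvC dotvBl !(dotvC _ w). Qed.

Lemma dotv_ge0 n (u : 'rV[R]_n) : 0 <= dotv u u.
Proof. by apply: sumr_ge0 => i _; rewrite -expr2 sqr_ge0. Qed.

Lemma enorm_ge0 n (u : 'rV[R]_n) : 0 <= enorm u.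
Proof. exact: sqrtr_ge0. Qed.

Lemma sqr_enorm n (u : 'rV[R]_n) : enorm u ^+ 2 = dotv u u.
Proof. by rewrite sqr_sqrtr// dotv_ge0. Qed.

Lemma coord_le_enorm n (u : 'rV[R]_n) i : `|u 0 i| <= enorm u.
Proof.
rewrite -sqrtr_sqr ler_wsqrtr// /dotv (bigD1 i)//= -expr2 lerDl.
by apply: sumr_ge0 => j _; rewrite -expr2 sqr_ge0.
Qed.

Lemma enorm_eq0 n (u : 'rV[R]_n) : enorm u = 0 -> u = 0.
Proof.
move=> u0; apply/rowP => i; rewrite mxE; apply/eqP; rewrite -normr_le0 -u0.
exact: coord_le_enorm.
Qed.

Lemma dotv_sqr_le n (u v : 'rV[R]_n) : dotv u v ^+ 2 <= dotv u u * dotv v v.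
Proof.
have [v0|v0] := eqVneq (dotv v v) 0.
  have -> : v = 0 by apply: enorm_eq0; rewrite /enorm v0 sqrtr0.
  by rewrite -(scale0r 0) !dotvZr !mul0r mulr0 expr0n.
have v_gt0 : 0 < dotv v v by rewrite lt_def v0 dotv_ge0.
have := dotv_ge0 (dotv v v *: u - dotv u v *: v).
rewrite dotvBl !dotvBr !dotvZl !dotvZr (dotvC v u) => residual_ge0.
rewrite -subr_ge0 -(pmulr_rge0 _ v_gt0); move: residual_ge0.
by congr (_ <= _); ring.
Qed.

Lemma cauchy_schwarz n (u v : 'rV[R]_n) : `|dotv u v| <= enorm u * enorm v.
Proof.
by rewrite -sqrtr_sqr /enorm -sqrtrM ?dotv_ge0// ler_wsqrtr// dotv_sqr_le.
Qed.

Lemma enormZ n a (u : 'rV[R]_n) : enorm (a *: u) = `|a| * enorm u.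
Proof.
by rewrite /enorm dotvZl dotvZr mulrA -expr2 sqrtrM ?sqr_ge0// sqrtr_sqr.
Qed.

Lemma enormN n (u : 'rV[R]_n) : enorm (- u) = enorm u.
Proof. by rewrite -scaleN1r enormZ normrN1 mul1r. Qed.

Lemma enorm0 n : enorm (0 : 'rV[R]_n) = 0.
Proof. by rewrite -(scale0r 0) enormZ normr0 mul0r. Qed.

Lemma enorm0_le1 n : enorm (0 : 'rV[R]_n) <= 1.
Proof. by rewrite enorm0. Qed.

Lemma enormD n (u v : 'rV[R]_n) : enorm (u + v) <= enorm u + enorm v.
Proof.
rewrite -(@ler_pXn2r _ 2)// ?nnegrE ?addr_ge0 ?enorm_ge0// sqr_enorm.
rewrite dotvDl !dotvDr (dotvC v u) sqrrD !sqr_enorm.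
by have := le_trans (ler_norm _) (cauchy_schwarz u v); lra.
Qed.

Lemma enorm_dual n (u : 'rV[R]_n) c : 0 <= c ->
  (forall e, `|dotv u e| <= c * enorm e) -> enorm u <= c.
Proof.
move=> c0 /(_ u); rewrite -sqr_enorm ger0_norm ?sqr_ge0// expr2.
have [->//|u0] := eqVneq (enorm u) 0.
by rewrite ler_pM2r// lt_def u0 enorm_ge0.
Qed.

Lemma enorm_le_coord n (u v : 'rV[R]_n) c : 0 <= c ->
  (forall i, `|u 0 i| <= c * `|v 0 i|) -> enorm u <= c * enorm v.
Proof.
move=> c0 uv; rewrite -(ger0_norm c0) -enormZ ler_wsqrtr//.
apply: ler_sum => i _; rewrite -!expr2 -real_normK ?num_real//.
rewrite -[leRHS]real_normK ?num_real//.
by rewrite mxE normrM (ger0_norm c0) ler_pXn2r ?nnegrE// mulr_ge0.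
Qed.

Lemma coord_le_mx_norm n (v : 'rV[R]_n) i : `|v 0 i| <= `|v|.
Proof.
rewrite [leRHS]/Num.norm/= mx_normrE.
exact: (le_bigmax _ (fun ij => `|v ij.1 ij.2|) (0, i)).
Qed.

Lemma mx_norm_eq_coord n (v : 'rV[R]_n) : (0 < n)%N ->
  exists i, `|v| = `|v 0 i|.
Proof.
move=> n0; have [->|v0] := eqVneq v 0.
  by exists (Ordinal n0); rewrite mxE !normr0.
have [|[i j] vij] := @mx_norm_neq0 _ _ _ v.
  by rewrite -[mx_norm v]/`|v| normr_eq0.
by exists j; rewrite [LHS]vij (ord1 i).
Qed.

Lemma sqr_enorm_le_mx_norm n (v : 'rV[R]_n) : enorm v ^+ 2 <= n%:R * `|v| ^+ 2.
Proof.
have -> : n%:R * `|v| ^+ 2 = \sum_(i < n) `|v| ^+ 2.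
  by rewrite sumr_const card_ord mulr_natl.
rewrite sqr_enorm; apply: ler_sum => i _.
rewrite -expr2 -real_normK ?num_real//.
by rewrite ler_pXn2r ?nnegrE// coord_le_mx_norm.
Qed.

Lemma linear_dotv n (g : 'rV[R]_n -> R) : linear g ->
  forall v, g v = dotv (\row_i g (evec i)) v.
Proof.
move=> g_lin v; pose gL : {linear 'rV[R]_n -> R} :=
  HB.pack g (GRing.isLinear.Build _ _ _ _ g g_lin).
rewrite -[g]/(gL : _ -> _) [in LHS](matrix_sum_delta v) big_ord1 linear_sum.
by apply: eq_bigr => i _; rewrite linearZ mxE mulrC.
Qed.

End Euclidean.

Lemma linear_row (R : realType) (U : lmodType R) n (g : 'I_n -> U -> R) :
  (forall i, linear (g i)) -> linear (fun u => \row_i g i u).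
Proof. by move=> g_lin a u v; apply/rowP => i; rewrite !mxE g_lin. Qed.

Section Seminorm.
Context {R : realType}.

Record is_seminorm (W : lmodType R) (N : W -> R) : Prop := {
  seminorm_ge0 : forall w, 0 <= N w ;
  seminormD : forall v w, N (v + w) <= N v + N w ;
  seminormZ : forall a w, N (a *: w) = `|a| * N w }.

Lemma enorm_seminorm n : is_seminorm (@enorm R n).
Proof.
split => [w|v w|a w]; [exact: enorm_ge0|exact: enormD|exact: enormZ].
Qed.

Lemma normr_seminorm : is_seminorm (@Num.norm R R).
Proof. by split => [w|v w|a w]; [|exact: ler_normD|exact: normrM]. Qed.

Definition sum_norm (V W : lmodType R) (NV : V -> R) (NW : W -> R)
    (p : V * W) : R :=
  NV p.1 + NW p.2.

Lemma sum_norm_seminorm (V W : lmodType R) (NV : V -> R) (NW : W -> R) :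
  is_seminorm NV -> is_seminorm NW -> is_seminorm (sum_norm NV NW).
Proof.
move=> semiV semiW; split => [w|v w|a w]; rewrite /sum_norm.
- by rewrite addr_ge0 ?(seminorm_ge0 semiV) ?(seminorm_ge0 semiW).
- by rewrite addrACA lerD ?(seminormD semiV) ?(seminormD semiW).
- by rewrite /= (seminormZ semiV) (seminormZ semiW) mulrDr.
Qed.

Lemma linear_le_enorm n (W : lmodType R) (N : W -> R) (T : 'rV[R]_n -> W) c :
  is_seminorm N -> linear T ->
  (forall u, enorm u <= 1 -> N (T u) <= c) -> forall u, N (T u) <= c * enorm u.
Proof.
move=> semiN /scalable_linear TZ Tc u.
have [/enorm_eq0 ->|u0] := eqVneq (enorm u) 0.
  by rewrite enorm0 mulr0 -(scale0r 0) TZ (seminormZ semiN) normr0 mul0r.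
have := Tc ((enorm u)^-1 *: u).
rewrite enormZ TZ (seminormZ semiN) ger0_norm ?invr_ge0 ?enorm_ge0// mulVf//.
by move=> /(_ (lexx _)); rewrite mulrC ler_pdivrMr// lt_def u0 enorm_ge0.
Qed.

Lemma bilinear_le_enorm m n (W : lmodType R) (N : W -> R)
    (T : 'rV[R]_m -> 'rV[R]_n -> W) c :
  is_seminorm N -> (forall v, linear (T ^~ v)) -> (forall u, linear (T u)) ->
  (forall u v, enorm u <= 1 -> enorm v <= 1 -> N (T u v) <= c) ->
  forall u v, N (T u v) <= c * enorm u * enorm v.
Proof.
move=> semiN T_linl T_linr Tc u v.
apply: (linear_le_enorm semiN (T_linr u)) => w w1.
by apply: (linear_le_enorm semiN (T_linl w)) => t t1; exact: Tc.
Qed.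

End Seminorm.

(** * Mean value and Taylor estimates *)

Section Directional_derivatives.
Context {R : realType}.

Lemma derive_linear (V W : normedModType R) (f : V -> W) x :
  differentiable f x -> linear (fun v => 'D_v f x).
Proof. by move=> df a u v; rewrite !deriveE// linearP. Qed.

Lemma is_diff_is_derive (V W : normedModType R) (f df : V -> W) x v :
  is_diff x f df -> is_derive x v f (df v).
Proof.
by move=> [f_diff dfE]; split; [exact: diff_derivable|rewrite deriveE// dfE].
Qed.

Lemma derive_linear_family (U : lmodType R) (V W : normedModType R)
    (g : U -> V -> W) v y :
  (forall z, linear (g ^~ z)) -> (forall u, differentiable (g u) y) ->
  linear (fun u => 'D_v (g u) y).
Proof.
move=> g_lin dg a u u'.
have -> : g (a *: u + u') = a \*: g u + g u'
  by apply/funext => z; rewrite g_lin.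
have gu w : derivable (g w) y v by exact: diff_derivable.
by rewrite deriveD ?deriveZ//; exact: derivableZ.
Qed.

Lemma is_derive_line (V W : normedModType R) (f : V -> W) x h t :
  differentiable f (x + t *: h) ->
  is_derive t 1 (fun s => f (x + s *: h)) ('D_h f (x + t *: h)).
Proof.
move=> df.
have quotientE :
    (fun s : R => s^-1 *: (f (x + (s *: (1 : R) + t) *: h) - f (x + t *: h)))
    = (fun s => s^-1 *: (f (s *: h + (x + t *: h)) - f (x + t *: h))).
  apply/funext => s; congr (_ *: (f _ - _)).
  by rewrite [s *: (1 : R)]mulr1 scalerDl addrCA.
split; last by rewrite /derive /= -quotientE.
by have := diff_derivable (v := h) df; rewrite /derivable /= -quotientE.
Qed.

Section Mean_value.
Variables (V : normedModType R) (f : V -> R).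
Hypothesis df : forall z, differentiable f z.

Lemma mean_value_line x h :
  exists2 c, 0 <= c <= 1 & f (x + h) - f x = 'D_h f (x + c *: h).
Proof.
have dline t :
    is_derive t (1 : R) (fun s => f (x + s *: h)) ('D_h f (x + t *: h)).
  exact: is_derive_line.
have [c c01] := @MVT_segment R (fun s => f (x + s *: h))
  (fun t => 'D_h f (x + t *: h)) 0 1 ler01 (fun t _ => dline t)
  (derivable_within_continuous (fun t _ => @ex_derive _ _ _ _ _ _ _ (dline t))).
by rewrite scale1r scale0r addr0 subr0 mulr1 => E; exists c.
Qed.

Lemma mean_value_le x h c :
  (forall z, `|'D_h f z| <= c) -> `|f (x + h) - f x| <= c.
Proof. by move=> fc; have [t _ ->] := mean_value_line x h. Qed.

End Mean_value.

Lemma taylor_le (V : normedModType R) (f : V -> R) x h c :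
  (forall z, differentiable f z) -> (forall z, differentiable ('D_h f) z) ->
  (forall z, `|'D_h ('D_h f) z| <= c) ->
  `|f (x + h) - f x - 'D_h f x| <= c.
Proof.
move=> df ddf fc; have [t /andP[t0 t1] ->] := mean_value_line df x h.
have [s _ ->] := mean_value_line ddf x (t *: h).
rewrite (scalable_linear (derive_linear (ddf _))) normrM ger0_norm//.
by apply: le_trans (fc (x + s *: (t *: h))); rewrite ler_piMl.
Qed.

Section Row_valued.
Variables (n : nat) (V : normedModType R) (F : V -> 'rV[R]_n).

Let dotvE e :
  (fun z => dotv (F z) e) = \sum_(i < n) e 0 i \*: (fun z => F z 0 i).
Proof.
by apply/funext => z; rewrite fct_sumE; apply: eq_bigr => i _; rewrite mulrC.
Qed.

Let differentiable_entry x i : differentiable F x ->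
  differentiable (fun z => F z 0 i) x.
Proof.
by move=> dF; apply: differentiable_comp dF (differentiable_coord _ _ _).
Qed.

Lemma differentiable_dotv x e : differentiable F x ->
  differentiable (fun z => dotv (F z) e) x.
Proof.
move=> dF; rewrite dotvE; apply: differentiable_sum => i.
exact/differentiableZ/differentiable_entry.
Qed.

Lemma derive_dotv x e h : differentiable F x ->
  'D_h (fun z => dotv (F z) e) x = dotv ('D_h F x) e.
Proof.
move=> dF; have dentry i : derivable (fun z => F z 0 i) x h.
  exact/diff_derivable/differentiable_entry.
rewrite dotvE derive_sum => [|i]; last exact: derivableZ.
apply: eq_bigr => i _; rewrite deriveZ// derive_mx ?mxE ?[_ *: _]mulrC//.
exact: diff_derivable.
Qed.

Lemma mean_value_row_le x h c : 0 <= c ->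
  (forall z, differentiable F z) -> (forall z, enorm ('D_h F z) <= c) ->
  enorm (F (x + h) - F x) <= c.
Proof.
move=> c0 dF Fc; apply: enorm_dual => // e; rewrite dotvBl.
apply: (mean_value_le (f := fun z => dotv (F z) e)) => z.
  exact: differentiable_dotv.
rewrite derive_dotv//; apply: le_trans (cauchy_schwarz _ _) _.
by rewrite ler_wpM2r ?enorm_ge0.
Qed.

End Row_valued.

Lemma taylor_row_le n (V : normedModType R) (F : V -> 'rV[R]_n) x h c :
  0 <= c ->
  (forall z, differentiable F z) -> (forall z, differentiable ('D_h F) z) ->
  (forall z, enorm ('D_h ('D_h F) z) <= c) ->
  enorm (F (x + h) - F x - 'D_h F x) <= c.
Proof.
move=> c0 dF ddF Fc; apply: enorm_dual => // e.
have deriveE : 'D_h (fun z => dotv (F z) e) = (fun z => dotv ('D_h F z) e).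
  by apply/funext => z; rewrite derive_dotv.
rewrite !dotvBl -derive_dotv//.
apply: (taylor_le (f := fun z => dotv (F z) e)) => z.
- exact: differentiable_dotv.
- by rewrite deriveE; exact: differentiable_dotv.
rewrite deriveE derive_dotv//; apply: le_trans (cauchy_schwarz _ _) _.
by rewrite ler_wpM2r ?enorm_ge0.
Qed.

End Directional_derivatives.

(** * Maps with a quadratic Taylor remainder *)

Section C11.
Context {R : realType}.
Implicit Types (U V W : lmodType R) (l q : R).

(* The derivative of [F] is the hidden witness [D]; the bound [q] on the
   remainder of the first-order expansion replaces a Lipschitz constant of
   [D]. *)
Definition C11_on U W (NU : U -> R) (NW : W -> R) (A : set U) (F : U -> W)
    l q :=
  exists D : U -> U -> W,
  [/\ forall x, linear (D x),
      forall x u, A x -> NW (D x u) <= l * NU u,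
      forall x y, A x -> A y -> NW (F y - F x) <= l * NU (y - x) &
      forall x y, A x -> A y ->
        NW (F y - F x - D x (y - x)) <= q * NU (y - x) ^+ 2].

Lemma C11_weaken U W (NU : U -> R) (NW : W -> R) A F l q l' q' :
  is_seminorm NU -> l <= l' -> q <= q' ->
  C11_on NU NW A F l q -> C11_on NU NW A F l' q'.
Proof.
move=> semiU ll qq [D [D_lin D_le F_inc F_rem]]; exists D.
split => // [x u Ax|x y Ax Ay|x y Ax Ay].
- by apply: le_trans (D_le x u Ax) _; rewrite ler_wpM2r ?(seminorm_ge0 semiU).
- by apply: le_trans (F_inc x y Ax Ay) _;
    rewrite ler_wpM2r ?(seminorm_ge0 semiU).
- by apply: le_trans (F_rem x y Ax Ay) _; rewrite ler_wpM2r ?sqr_ge0.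
Qed.

Lemma linear_C11 U W (NU : U -> R) (NW : W -> R) A (T : U -> W) l :
  is_seminorm NW -> linear T -> (forall u, NW (T u) <= l * NU u) ->
  C11_on NU NW A T l 0.
Proof.
move=> semiW T_lin T_le; exists (fun=> T).
have TB := zmod_morphism_linear T_lin.
split => // x y _ _; rewrite -TB//.
by rewrite subrr mul0r -(scale0r 0) (seminormZ semiW) normr0 mul0r.
Qed.

Lemma C11D U W (NU : U -> R) (NW : W -> R) A F G l q l' q' :
  is_seminorm NW -> C11_on NU NW A F l q -> C11_on NU NW A G l' q' ->
  C11_on NU NW A (fun x => F x + G x) (l + l') (q + q').
Proof.
move=> semiW [D [D_lin D_le F_inc F_rem]] [E [E_lin E_le G_inc G_rem]].
exists (fun x u => D x u + E x u).
split => [x a u v|x u Ax|x y Ax Ay|x y Ax Ay].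
- by rewrite D_lin E_lin scalerDr addrACA.
- by rewrite mulrDl; apply: le_trans (seminormD semiW _ _) _;
    rewrite lerD ?D_le ?E_le.
- rewrite mulrDl opprD addrACA; apply: le_trans (seminormD semiW _ _) _.
  by rewrite lerD ?F_inc ?G_inc.
- rewrite mulrDl !opprD [F y + _ + _]addrACA [X in NW X]addrACA.
  apply: le_trans (seminormD semiW _ _) _.
  by rewrite lerD ?F_rem ?G_rem.
Qed.

Lemma C11_pair U V W (NU : U -> R) (NV : V -> R) (NW : W -> R) A F G l q l' q' :
  C11_on NU NV A F l q -> C11_on NU NW A G l' q' ->
  C11_on NU (sum_norm NV NW) A (fun x => (F x, G x)) (l + l') (q + q').
Proof.
move=> [D [D_lin D_le F_inc F_rem]] [E [E_lin E_le G_inc G_rem]].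
exists (fun x u => (D x u, E x u)).
split => [x a u v|x u Ax|x y Ax Ay|x y Ax Ay]; rewrite ?mulrDl ?lerD//=.
- by rewrite D_lin E_lin.
- exact: D_le.
- exact: E_le.
- exact: F_inc.
- exact: G_inc.
- exact: F_rem.
- exact: G_rem.
Qed.

Lemma C11_comp U V W (NU : U -> R) (NV : V -> R) (NW : W -> R)
    (A : set U) (B : set V) F G l q l' q' :
  is_seminorm NV -> is_seminorm NW -> 0 <= l' -> 0 <= q' ->
  (forall x, A x -> B (F x)) ->
  C11_on NU NV A F l q -> C11_on NV NW B G l' q' ->
  C11_on NU NW A (G \o F) (l' * l) (q' * l ^+ 2 + l' * q).
Proof.
move=> semiV semiW l'0 q'0 AB [D [D_lin D_le F_inc F_rem]].
move=> [E [E_lin E_le G_inc G_rem]].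
exists (fun x u => E (F x) (D x u)).
split => [x a u v|x u Ax|x y Ax Ay|x y Ax Ay] /=.
- by rewrite D_lin E_lin.
- apply: le_trans (E_le _ _ (AB _ Ax)) _; rewrite -mulrA ler_wpM2l//.
  exact: D_le.
- apply: le_trans (G_inc _ _ (AB _ Ax) (AB _ Ay)) _.
  by rewrite -mulrA ler_wpM2l//; exact: F_inc.
rewrite -[G _ - _](subrK (E (F x) (F y - F x))) -addrA.
rewrite -(zmod_morphism_linear (E_lin (F x))) mulrDl.
apply: le_trans (seminormD semiW _ _) _; apply: lerD.
  apply: le_trans (G_rem _ _ (AB _ Ax) (AB _ Ay)) _.
  rewrite -mulrA -exprMn ler_wpM2l// lerXn2r ?nnegrE ?(seminorm_ge0 semiV)//.
    by apply: le_trans (F_inc _ _ Ax Ay); exact: seminorm_ge0.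
  exact: F_inc.
apply: le_trans (E_le _ _ (AB _ Ax)) _.
by rewrite -mulrA ler_wpM2l//; exact: F_rem.
Qed.

End C11.

Local Notation C11_row := (C11_on (@enorm _ _) (@enorm _ _)).
Local Notation C11_fun := (C11_on (@enorm _ _) (@Num.norm _ _)).

Section Quadratic_remainder.
Context {R : realType}.
Variables (n : nat) (f : 'rV[R]_n -> R).

Lemma continuous_linear_row (g : 'rV[R]_n -> R) : linear g -> continuous g.
Proof.
move=> g_lin x; apply: differentiable_continuous.
have -> : g = \sum_(i < n) (g (evec i) \*: (fun v : 'rV[R]_n => v 0 i)).
  apply/funext => v; rewrite fct_sumE (linear_dotv g_lin).
  by apply: eq_bigr => i _; rewrite mxE.
by apply: differentiable_sum => i; exact/differentiableZ/differentiable_coord.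
Qed.

Lemma quadratic_remainder_is_diff (g : 'rV[R]_n -> R) x Q : linear g ->
  (forall y, `|f y - f x - g (y - x)| <= Q * enorm (y - x) ^+ 2) ->
  is_diff x f g.
Proof.
move=> g_lin fg; have g_cts := continuous_linear_row g_lin.
pose gL : {linear 'rV[R]_n -> R} :=
  HB.pack g (GRing.isLinear.Build _ _ _ _ g g_lin).
have f_expansion : (f : 'rV[R]_n -> R^o) \o shift x
    = cst (f x) + (gL : _ -> R^o) +o_ (0 : 'rV[R]_n) id.
  apply/eqaddoP => _/posnumP[e].
  have slope_gt0 : 0 < `|Q| * n%:R + 1 by rewrite ltr_wpDl// mulr_ge0.
  have small :
      \forall h \near (0 : 'rV[R]_n), `|h| <= e%:num / (`|Q| * n%:R + 1).
    by apply: nbhs0_le; rewrite divr_gt0.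
  apply: filterS small => h h_le; rewrite [X in Num.norm X](_ : _ =
      f (h + x) - f x - g (h + x - x)); last by rewrite addrK /= -addrA -opprD.
  apply: le_trans (fg _) _; rewrite addrK.
  apply: (@le_trans _ _ (`|Q| * (n%:R * `|h| ^+ 2))).
    apply: le_trans (ler_wpM2r (sqr_ge0 _) (ler_norm Q)) _.
    by rewrite ler_wpM2l// sqr_enorm_le_mx_norm.
  apply: (@le_trans _ _ ((`|Q| * n%:R + 1) * `|h| * `|h|)).
    by rewrite mulrA -[leRHS]mulrA -expr2 ler_wpM2r// lerDl.
  by rewrite ler_wpM2r// mulrC -ler_pdivlMr.
have dfE : 'd f x = gL :> (_ -> _).
  exact: (@diff_unique R _ R^o f gL x g_cts f_expansion).
by apply: DiffDef => //; apply/diff_locallyP; rewrite dfE; split.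
Qed.

Lemma C11_differentiable l q : C11_fun setT f l q ->
  forall x, differentiable f x.
Proof.
move=> [D [D_lin _ _ f_rem]] x.
by have [] := quadratic_remainder_is_diff (D_lin x) (fun y => f_rem x y I I).
Qed.

Lemma dotv_grad x v : differentiable f x -> dotv (grad f x) v = 'D_v f x.
Proof. by move=> df; rewrite (linear_dotv (derive_linear df)). Qed.

Section Gradient.
Variable Q : R.
Hypothesis df : forall x, differentiable f x.
Hypothesis f_rem : forall x y,
  `|f y - f x - 'D_(y - x) f x| <= Q * enorm (y - x) ^+ 2.

(* Compare the expansions of [f (y + w)] at [x] and at [y]. *)
Lemma grad_increment_le x y w : `|dotv (grad f y - grad f x) w|
  <= Q * (enorm (y - x + w) ^+ 2 + enorm w ^+ 2 + enorm (y - x) ^+ 2).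
Proof.
have at_x := f_rem x (y + w); have at_y := f_rem y (y + w).
have xy := f_rem x y.
have wE : y + w - x = y - x + w by rewrite addrAC.
move: at_x at_y xy; rewrite wE [y + w - y]addrC addKr.
rewrite -!dotv_grad// dotvBl dotvDr.
rewrite !mulrDr !ler_norml; lra.
Qed.

Lemma grad_lipschitz x y : 0 <= Q ->
  enorm (grad f x - grad f y) <= 6 * Q * enorm (x - y).
Proof.
move=> Q0; set g := _ - _; set r := enorm (x - y).
have [g0|g0] := eqVneq (enorm g) 0; first by rewrite g0 !mulr_ge0// enorm_ge0.
have [/enorm_eq0/eqP|r0] := eqVneq r 0.
  rewrite subr_eq0 => /eqP xy.
  by rewrite /g xy subrr enorm0 !mulr_ge0// enorm_ge0.
have g_gt0 : 0 < enorm g by rewrite lt_def g0 enorm_ge0.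
have r_gt0 : 0 < r by rewrite lt_def r0 enorm_ge0.
pose w := (r / enorm g) *: g.
have wr : enorm w = r.
  by rewrite enormZ ger0_norm ?divr_ge0 ?enorm_ge0// divfK.
have := grad_increment_le y x w; rewrite -/g -/r wr dotvZr -sqr_enorm.
have -> : r / enorm g * enorm g ^+ 2 = enorm g * r by field.
have : enorm (x - y + w) ^+ 2 <= (2 * r) ^+ 2.
  rewrite lerXn2r ?nnegrE ?enorm_ge0 ?mulr_ge0 ?(ltW r_gt0)//.
  by apply: le_trans (enormD _ _) _; rewrite wr -/r; lra.
rewrite ger0_norm ?mulr_ge0 ?enorm_ge0// => xyw_le grad_le.
rewrite -(ler_pM2r r_gt0); apply: le_trans grad_le _.
have -> : 6 * Q * r * r = Q * ((2 * r) ^+ 2 + r ^+ 2 + r ^+ 2) by ring.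
by rewrite ler_wpM2l// !lerD2r.
Qed.

End Gradient.
End Quadratic_remainder.

Section Bounded_derivatives.
Context {R : realType}.

Definition C2_bounded m n (F : 'rV[R]_m -> 'rV[R]_n) c :=
  [/\ forall x, differentiable F x,
      forall v x, differentiable ('D_v F) x &
      forall x (v w : 'rV[R]_m), enorm v <= 1 -> enorm w <= 1 ->
        enorm ('D_v F x) <= c /\ enorm ('D_w ('D_v F) x) <= c].

Lemma C2_bounded_C11 m n (F : 'rV[R]_m -> 'rV[R]_n) c :
  C2_bounded F c -> C11_row setT F c c.
Proof.
move=> [dF ddF F_le]; have semiN := @enorm_seminorm R n.
have zero_le1 := @enorm0_le1 R m.
have c0 : 0 <= c := le_trans (enorm_ge0 _) (F_le 0 _ _ zero_le1 zero_le1).1.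
have D1_le x v : enorm ('D_v F x) <= c * enorm v.
  apply: (linear_le_enorm semiN (derive_linear (dF x))) => u u1.
  exact: (F_le _ _ _ u1 zero_le1).1.
have D2_le x v w : enorm ('D_w ('D_v F) x) <= c * enorm v * enorm w.
  apply: (bilinear_le_enorm (T := fun v w => 'D_w ('D_v F) x) semiN)
    => [u|u|u t u1 t1].
  - by apply: derive_linear_family => // y; exact: derive_linear.
  - exact: derive_linear.
  - exact: (F_le _ _ _ u1 t1).2.
exists (fun x v => 'D_v F x); split => // [x|x y _ _|x y _ _].
- exact: derive_linear.
- rewrite -{1}(subrKC x y); apply: mean_value_row_le => //.
  by rewrite mulr_ge0 ?enorm_ge0.
- rewrite -{1}(subrKC x y); apply: taylor_row_le => // [|z].
    by rewrite mulr_ge0 ?sqr_ge0.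
  by rewrite expr2 mulrA; exact: D2_le.
Qed.

End Bounded_derivatives.

(** * Kernel and score *)

Section Kernel.
Context {R : realType}.
Variables (n : nat) (k : 'rV[R]_n -> 'rV[R]_n -> R) (b : R).

Definition kernel_C2_bounded :=
  [/\ forall y x, differentiable (k ^~ y) x,
      forall y u x, differentiable ('D_u (k ^~ y)) x,
      forall x u y, differentiable (fun y' => 'D_u (k ^~ y') x) y &
      forall x y (u v : 'rV[R]_n), enorm u <= 1 -> enorm v <= 1 ->
        [/\ k x y <= b, `|'D_u (k ^~ y) x| <= b, `|'D_v ('D_u (k ^~ y)) x| <= b
          & `|'D_v (fun y' => 'D_u (k ^~ y') x) y| <= b]].

Hypothesis k_psd : cont_psd_kernel k.
Hypothesis k_C2 : kernel_C2_bounded.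

Let k_sym x y : k x y = k y x. Proof. by have [_ []] := k_psd. Qed.
Let dk y x : differentiable (k ^~ y) x. Proof. by have [] := k_C2. Qed.
Let d11k y u x : differentiable ('D_u (k ^~ y)) x.
Proof. by have [] := k_C2. Qed.
Let d12k x u y : differentiable (fun y' => 'D_u (k ^~ y') x) y.
Proof. by have [] := k_C2. Qed.
Let zero_le1 := @enorm0_le1 R n.
Let semiR := @normr_seminorm R.

Lemma psd_kernel_bound x y : `|k x y| <= b.
Proof.
have [_ _ _ k_le] := k_C2; have [_ [_ k_gram]] := k_psd.
have [kx _ _ _] := k_le x x _ _ zero_le1 zero_le1.
have [ky _ _ _] := k_le y y _ _ zero_le1 zero_le1.
have gram c : 0 <= k x x + c * k x y + (c * k y x + c * c * k y y).
  have := k_gram 2 (fun i => if i == 0 then x else y)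
                   (fun i => if i == 0 then 1 else c).
  by rewrite !big_ord_recl !big_ord0 /= !addr0 !mul1r mulr1.
have := gram 1; have := gram (-1); rewrite (k_sym y x) ler_norml; lra.
Qed.

Lemma kernel_D1_le x y u : `|'D_u (k ^~ y) x| <= b * enorm u.
Proof.
have [_ _ _ k_le] := k_C2.
apply: (linear_le_enorm semiR (derive_linear (dk y x))) => v v1.
by have [] := k_le x y _ _ v1 zero_le1.
Qed.

Lemma kernel_D11_le x y u v :
  `|'D_v ('D_u (k ^~ y)) x| <= b * enorm u * enorm v.
Proof.
have [_ _ _ k_le] := k_C2.
apply: (bilinear_le_enorm (T := fun u v => 'D_v ('D_u (k ^~ y)) x) semiR)
  => [w|w|w t w1 t1].
- by apply: derive_linear_family => // z; exact: derive_linear.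
- exact: derive_linear.
- by have [_ _ D11_le _] := k_le x y _ _ w1 t1; exact: D11_le.
Qed.

Lemma kernel_D12_le x y u v :
  `|'D_v (fun y' => 'D_u (k ^~ y') x) y| <= b * enorm u * enorm v.
Proof.
have [_ _ _ k_le] := k_C2.
apply: (bilinear_le_enorm
  (T := fun u v => 'D_v (fun y' => 'D_u (k ^~ y') x) y) semiR)
  => [w|w|w t w1 t1].
- apply: (derive_linear_family (g := fun u y' => 'D_u (k ^~ y') x)) => // z.
  exact: derive_linear.
- exact: derive_linear.
- by have [_ _ _ D12_le] := k_le x y _ _ w1 t1; exact: D12_le.
Qed.

Lemma kernel_increment_le x y h l :
  `|k (x + h) (y + l) - k x y| <= b * (enorm h + enorm l).
Proof.
have incx : `|k (x + h) (y + l) - k x (y + l)| <= b * enorm h.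
  by apply: (mean_value_le (dk (y + l))) => z; exact: kernel_D1_le.
have incy : `|k (y + l) x - k y x| <= b * enorm l.
  by apply: (mean_value_le (dk x)) => z; exact: kernel_D1_le.
rewrite -(subrKA (k x (y + l))) mulrDr; apply: le_trans (ler_normD _ _) _.
by rewrite lerD// (k_sym x) (k_sym x).
Qed.

(* The increment in the second argument is expanded by the symmetry of [k],
   so that only derivatives in the first argument occur. *)
Lemma kernel_taylor_le x y h l :
  `|k (x + h) (y + l) - k x y - ('D_h (k ^~ y) x + 'D_l (k ^~ x) y)|
    <= b * (enorm h + enorm l) ^+ 2.
Proof.
have taylorx : `|k (x + h) (y + l) - k x (y + l) - 'D_h (k ^~ (y + l)) x|
    <= b * enorm h * enorm h.
  by apply: (taylor_le (f := k ^~ (y + l))) => // z; exact: kernel_D11_le.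
have taylory :
    `|k (y + l) x - k y x - 'D_l (k ^~ x) y| <= b * enorm l * enorm l.
  by apply: (taylor_le (f := k ^~ x)) => // z; exact: kernel_D11_le.
have mixed :
    `|'D_h (k ^~ (y + l)) x - 'D_h (k ^~ y) x| <= b * enorm h * enorm l.
  apply: (mean_value_le (f := fun y' => 'D_h (k ^~ y') x)) => // z.
  exact: kernel_D12_le.
have b_ge0 : 0 <= b := le_trans (normr_ge0 _) (psd_kernel_bound x y).
have cross_ge0 : 0 <= b * enorm h * enorm l by rewrite !mulr_ge0 ?enorm_ge0.
have -> : b * (enorm h + enorm l) ^+ 2 = b * enorm h * enorm h
  + b * enorm l * enorm l + 2 * (b * enorm h * enorm l) by ring.
move: taylorx taylory mixed; rewrite (k_sym _ x) (k_sym y x) !ler_norml; lra.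
Qed.

Lemma kernel_C11 : C11_on (sum_norm (@enorm R n) (@enorm R n)) (@Num.norm R R)
  setT (fun p : 'rV[R]_n * 'rV[R]_n => k p.1 p.2) b b.
Proof.
exists (fun p u => 'D_u.1 (k ^~ p.2) p.1 + 'D_u.2 (k ^~ p.1) p.2).
split => [p a u v|p u _|p r _ _|p r _ _] /=.
- rewrite (derive_linear (dk _ _)) (derive_linear (dk _ _)).
  by rewrite scalerDr addrACA.
- apply: le_trans (ler_normD _ _) _.
  by rewrite mulrDr lerD ?kernel_D1_le.
- by rewrite -{1}(subrKC p.1 r.1) -{1}(subrKC p.2 r.2) kernel_increment_le.
- by rewrite -{1}(subrKC p.1 r.1) -{1}(subrKC p.2 r.2) kernel_taylor_le.
Qed.

End Kernel.

Section Score.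
Context {R : realType}.
Variables (n : nat) (f : 'rV[R]_n -> R) (L M : R).

Definition C3_bounded := C3 f /\
  forall x (u v w : 'rV[R]_n), enorm u <= 1 -> enorm v <= 1 -> enorm w <= 1 ->
    `|'D_u ('D_v f) x| <= L /\ `|'D_u ('D_v ('D_w f)) x| <= M.

Hypothesis f_C3 : C3_bounded.

Let df x : differentiable f x. Proof. by have [[]] := f_C3. Qed.
Let ddf v x : differentiable ('D_v f) x. Proof. by have [[_ []]] := f_C3. Qed.
Let dddf u v x : differentiable ('D_u ('D_v f)) x.
Proof. by have [[_ [_ []]]] := f_C3. Qed.
Let zero_le1 := @enorm0_le1 R n.
Let semiR := @normr_seminorm R.
Let D2_linear u x : linear (fun v => 'D_u ('D_v f) x).
Proof. by apply: derive_linear_family => // y; exact: derive_linear. Qed.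

Lemma C3_bounded_ge0 : 0 <= L /\ 0 <= M.
Proof.
have [DL DM] := f_C3.2 0 _ _ _ zero_le1 zero_le1 zero_le1.
by split; [exact: le_trans DL|exact: le_trans DM].
Qed.

Let L_ge0 : 0 <= L := C3_bounded_ge0.1.
Let M_ge0 : 0 <= M := C3_bounded_ge0.2.

Lemma C3_bounded_D2_le x u v : `|'D_u ('D_v f) x| <= L * enorm u * enorm v.
Proof.
apply: (bilinear_le_enorm (T := fun u v => 'D_u ('D_v f) x) semiR)
  => [w|w|w t w1 t1].
- exact: derive_linear.
- exact: D2_linear.
- exact: (f_C3.2 x _ _ _ w1 t1 zero_le1).1.
Qed.

Lemma C3_bounded_D3_le x u v w :
  `|'D_u ('D_v ('D_w f)) x| <= M * enorm u * enorm v * enorm w.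
Proof.
apply: (linear_le_enorm (T := fun w => 'D_u ('D_v ('D_w f)) x) semiR)
  => [|t t1].
  by apply: (derive_linear_family (g := fun w => 'D_v ('D_w f))).
apply: (bilinear_le_enorm (T := fun u v => 'D_u ('D_v ('D_t f)) x) semiR)
  => [s|s|s r s1 r1].
- exact: derive_linear.
- by apply: derive_linear_family => // y; exact: derive_linear.
- exact: (f_C3.2 x _ _ _ s1 r1 t1).2.
Qed.

Lemma grad_C11 : C11_row setT (grad f) L M.
Proof.
pose H x u : 'rV[R]_n := \row_i 'D_u ('D_(evec i) f) x.
have dotvH x u e : dotv (H x u) e = 'D_u ('D_e f) x.
  by rewrite (linear_dotv (D2_linear u x)).
exists H; split => [x|x u _|x y _ _|x y _ _].
- by apply: linear_row => i; exact: derive_linear.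
- apply: enorm_dual => [|e]; first by rewrite mulr_ge0 ?enorm_ge0.
  by rewrite dotvH; exact: C3_bounded_D2_le.
- apply: enorm_dual => [|e]; first by rewrite mulr_ge0 ?enorm_ge0.
  rewrite dotvBl !dotv_grad// -{1}(subrKC x y).
  by apply: (mean_value_le (ddf e)) => z; exact: C3_bounded_D2_le.
- apply: enorm_dual => [|e]; first by rewrite mulr_ge0 ?sqr_ge0.
  rewrite !dotvBl !dotv_grad// dotvH -{1}(subrKC x y).
  apply: (taylor_le x (ddf e) (dddf (y - x) e)) => z.
  by rewrite expr2 mulrA; exact: C3_bounded_D3_le.
Qed.

End Score.

Section Entrywise.
Context {R : realType}.
Variables (n : nat) (x : 'rV[R]_n) (b : R).
Hypotheses (b_ge0 : 0 <= b) (x_le : forall i, `|x 0 i| <= b).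

Lemma hadam_le u : enorm (hadam u x) <= b * enorm u.
Proof.
by apply: enorm_le_coord => // i; rewrite mxE normrM mulrC ler_wpM2r.
Qed.

Lemma hadam_linear : linear (fun u => hadam u x).
Proof. by move=> a u v; apply/rowP => i; rewrite !mxE mulrDl mulrA. Qed.

Variable r : R.
Hypothesis r_gt0 : 0 < r.

Let inv_le y : r^-1 <= y -> 0 < y /\ y^-1 <= r.
Proof.
move=> ry; have y0 : 0 < y by apply: lt_le_trans ry; rewrite invr_gt0.
by split; rewrite // -[leRHS]invrK lef_pV2 ?posrE ?invr_gt0.
Qed.

Lemma ediv_le (s : 'rV[R]_n) : (forall i, r^-1 <= s 0 i) ->
  enorm (ediv x s) <= r * enorm x.
Proof.
move=> s_ge; apply: enorm_le_coord => [|i]; first exact: ltW.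
have [s0 sr] := inv_le (s_ge i).
by rewrite mxE normrM mulrC ler_wpM2r// gtr0_norm ?invr_gt0.
Qed.

Lemma ediv_C11 : C11_row [set s | forall i, r^-1 <= s 0 i] (ediv x)
  (b * r ^+ 2) (b * r ^+ 3).
Proof.
exists (fun s v : 'rV[R]_n => \row_i (- (x 0 i / s 0 i ^+ 2) * v 0 i)).
split => [s|s v s_ge|s t s_ge t_ge|s t s_ge t_ge].
- by apply: linear_row => i a u v; rewrite !mxE mulrDr mulrCA.
- apply: enorm_le_coord => [|i]; first by rewrite mulr_ge0// sqr_ge0.
  have [s0 sr] := inv_le (s_ge i).
  rewrite mxE normrM ler_wpM2r// normrN normrM ler_pM//.
  rewrite gtr0_norm ?invr_gt0 ?exprn_gt0//.
  by rewrite -exprVn lerXn2r// nnegrE ?invr_ge0 ltW.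
- apply: enorm_le_coord => [|i]; first by rewrite mulr_ge0// sqr_ge0.
  have [s0 sr] := inv_le (s_ge i); have [t0 tr] := inv_le (t_ge i).
  have -> : (ediv x t - ediv x s) 0 i = - (x 0 i * ((s 0 i)^-1 * (t 0 i)^-1))
      * (t - s) 0 i by rewrite !mxE; field; rewrite !gt_eqF.
  rewrite normrM ler_wpM2r// normrN normrM ler_pM//.
  rewrite gtr0_norm ?mulr_gt0 ?invr_gt0//.
  by rewrite expr2 ler_pM// invr_ge0 ltW.
rewrite [X in _ <= _ * X]expr2 [leRHS]mulrA; apply: enorm_le_coord => [|i].
  by rewrite !mulr_ge0 ?enorm_ge0// ?exprn_ge0// ltW.
have [s0 sr] := inv_le (s_ge i); have [t0 tr] := inv_le (t_ge i).
rewrite [X in `|X| <= _](_ : _ = x 0 i * ((s 0 i)^-1 ^+ 2 * (t 0 i)^-1)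
    * (t - s) 0 i * (t - s) 0 i); last by rewrite !mxE; field; rewrite !gt_eqF.
rewrite normrM ler_wpM2r// normrM ler_pM ?coord_le_enorm// normrM ler_pM//.
rewrite gtr0_norm ?mulr_gt0 ?exprn_gt0 ?invr_gt0// [r ^+ 3]exprSr.
have [s_inv t_inv] : 0 <= (s 0 i)^-1 /\ 0 <= (t 0 i)^-1
  by rewrite !invr_ge0 !ltW.
by rewrite ler_pM ?exprn_ge0// lerXn2r// nnegrE ltW.
Qed.

End Entrywise.

(** * The integrand *)

Section Product_expansion.
Context {R : realType}.

Lemma dotv_sumE T n (F G : T -> 'rV[R]_n) : (fun y => dotv (F y) (G y)) =
  \sum_(i < n) (fun y => F y 0 i) * (fun y => G y 0 i).
Proof. by apply/funext => y; rewrite fct_sumE. Qed.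

Lemma scaled_dotv_remainderE n (k1 k2 dk : R) (F1 F2 G1 G2 dF dG : 'rV[R]_n) :
  k2 * dotv F2 G2 - k1 * dotv F1 G1
    - (dk * dotv F1 G1 + k1 * (dotv dF G1 + dotv F1 dG)) =
  (k2 - k1 - dk) * dotv F1 G1
  + (k2 - k1) * (dotv (F2 - F1) G2 + dotv F1 (G2 - G1))
  + k1 * (dotv (F2 - F1 - dF) G1 + dotv (F2 - F1) (G2 - G1)
          + dotv F1 (G2 - G1 - dG)).
Proof. rewrite !(dotvBl, dotvBr); ring. Qed.

Lemma dotv_is_derive m n (F G : 'rV[R]_m -> 'rV[R]_n) x v (dF dG : 'rV[R]_n) :
  (forall i, is_derive x v (fun y => F y 0 i) (dF 0 i)) ->
  (forall i, is_derive x v (fun y => G y 0 i) (dG 0 i)) ->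
  is_derive x v (fun y => dotv (F y) (G y)) (dotv dF (G x) + dotv (F x) dG).
Proof.
move=> dFx dGx; rewrite dotv_sumE.
have dFG i := is_deriveM (dFx i) (dGx i); apply: is_derive_eq.
rewrite /dotv -big_split; apply: eq_bigr => i _ /=.
by rewrite addrC; congr (_ + _); rewrite mulrC.
Qed.

Lemma dotv_le n (F G : 'rV[R]_n) c e :
  enorm F <= c -> enorm G <= e -> `|dotv F G| <= c * e.
Proof.
move=> Fc Ge; apply: le_trans (cauchy_schwarz _ _) _.
by rewrite ler_pM ?enorm_ge0.
Qed.

Lemma row_remainder_is_diff m n (F g : 'rV[R]_m -> 'rV[R]_n) x Q i : linear g ->
  (forall y, enorm (F y - F x - g (y - x)) <= Q * enorm (y - x) ^+ 2) ->
  is_diff x (fun y => F y 0 i) (fun u => g u 0 i).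
Proof.
move=> g_lin Fg; apply: (@quadratic_remainder_is_diff _ _ _ _ _ Q) => [a u v|y].
  by rewrite g_lin !mxE.
apply: le_trans (Fg y).
by have := coord_le_enorm (F y - F x - g (y - x)) i; rewrite !mxE.
Qed.

Variables (m n : nat) (kappa : 'rV[R]_m -> R) (F G : 'rV[R]_m -> 'rV[R]_n).
Variables (b lk qk lF qF lG qG : R).
Hypothesis kappa_le : forall x, `|kappa x| <= b.
Hypothesis kappa_C11 : C11_fun setT kappa lk qk.
Hypothesis F_C11 : C11_row setT F lF qF.
Hypothesis G_C11 : C11_row setT G lG qG.

Let h x := kappa x * dotv (F x) (G x).

Lemma scaled_dotv_differentiable x : differentiable h x.
Proof.
apply: differentiableM; first exact: C11_differentiable kappa_C11 x.
have [dF [dF_lin _ _ F_rem]] := F_C11; have [dG [dG_lin _ _ G_rem]] := G_C11.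
rewrite dotv_sumE; apply: differentiable_sum => i.
have [dFx _] := row_remainder_is_diff i (dF_lin x) (fun z => F_rem x z I I).
have [dGx _] := row_remainder_is_diff i (dG_lin x) (fun z => G_rem x z I I).
exact: differentiableM.
Qed.

Lemma scaled_dotv_remainder_le x y :
  `|h y - h x - 'D_(y - x) h x| <=
    (qk * (enorm (F x) * enorm (G x))
     + lk * (lF * enorm (G y) + enorm (F x) * lG)
     + b * (qF * enorm (G x) + lF * lG + enorm (F x) * qG))
    * enorm (y - x) ^+ 2.
Proof.
have [dk [dk_lin _ k_inc k_rem]] := kappa_C11.
have [dF [dF_lin _ F_inc F_rem]] := F_C11.
have [dG [dG_lin _ G_inc G_rem]] := G_C11.
set v := y - x.
have DhE : 'D_v h x = dk x v * dotv (F x) (G x)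
    + kappa x * (dotv (dF x v) (G x) + dotv (F x) (dG x v)).
  have dkx := quadratic_remainder_is_diff (dk_lin x) (fun z => k_rem x z I I).
  have dFGx : is_derive x v (fun z => dotv (F z) (G z))
      (dotv (dF x v) (G x) + dotv (F x) (dG x v)).
    have dFx i := row_remainder_is_diff i (dF_lin x) (fun z => F_rem x z I I).
    have dGx i := row_remainder_is_diff i (dG_lin x) (fun z => G_rem x z I I).
    by apply: dotv_is_derive => i;
      [exact: (is_diff_is_derive v (dFx i))
      |exact: (is_diff_is_derive v (dGx i))].
  have [_ ->] := is_deriveM (is_diff_is_derive v dkx) dFGx; rewrite addrC.
  congr (_ + _); exact: mulrC.
rewrite DhE scaled_dotv_remainderE; set t := enorm v.
rewrite [leRHS](_ : _ = qk * t ^+ 2 * (enorm (F x) * enorm (G x))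
  + lk * t * (lF * t * enorm (G y) + enorm (F x) * (lG * t))
  + b * (qF * t ^+ 2 * enorm (G x) + lF * t * (lG * t)
         + enorm (F x) * (qG * t ^+ 2))); last by ring.
have F_inc_xy := F_inc x y I I; have G_inc_xy := G_inc x y I I.
apply: le_trans (ler_normD _ _) _; apply: lerD.
  apply: le_trans (ler_normD _ _) _; rewrite !normrM.
  apply: lerD; apply: ler_pM => //.
  - exact: k_rem.
  - exact: dotv_le.
  - exact: k_inc.
  - by apply: le_trans (ler_normD _ _) _; apply: lerD; exact: dotv_le.
rewrite normrM; apply: ler_pM => //.
apply: le_trans (ler_normD _ _) _; apply: lerD.
  apply: le_trans (ler_normD _ _) _; apply: lerD; apply: dotv_le => //.
  exact: F_rem.
by apply: dotv_le => //; exact: G_rem.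
Qed.

End Product_expansion.

Section Kernel_pairing.
Context {R : realType}.
Variables (m n : nat) (k : 'rV[R]_n -> 'rV[R]_n -> R) (b : R).
Variables (X X' F F' : 'rV[R]_m -> 'rV[R]_n) (A A' N : R).
Hypothesis k_psd : cont_psd_kernel k.
Hypothesis k_C2 : kernel_C2_bounded k b.
Hypotheses (A_ge1 : 1 <= A) (A_ge1' : 1 <= A') (N_ge0 : 0 <= N).
Hypotheses (X_C11 : C11_row setT X A A) (X_C11' : C11_row setT X' A' A').
Hypothesis F_C11 : C11_row setT F (N * A) (N * A ^+ 2).
Hypothesis F_C11' : C11_row setT F' (N * A') (N * A' ^+ 2).

Let S := A + A'.
Let S_ge1 : 1 <= S. Proof. by rewrite /S; move: A_ge1 A_ge1'; lra. Qed.
Let b_ge0 : 0 <= b := le_trans (normr_ge0 _) (psd_kernel_bound k_psd k_C2 0 0).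

Lemma kernel_pairing_C11 :
  C11_fun setT (fun x => k (X x) (X' x)) (b * S) (2 * b * S ^+ 2).
Proof.
have semiE := @enorm_seminorm R.
have XX_C11 := C11_pair X_C11 X_C11'.
have := C11_comp (sum_norm_seminorm (semiE _) (semiE _)) (@normr_seminorm R)
  b_ge0 b_ge0 (fun x _ => I) XX_C11 (kernel_C11 k_psd k_C2).
apply: C11_weaken => //.
have -> : 2 * b * S ^+ 2 = b * S ^+ 2 + b * S ^+ 2 by ring.
by rewrite lerD2l ler_wpM2l// expr2 ler_peMl ?S_ge1// (le_trans ler01 S_ge1).
Qed.

Let rescale c (H : 'rV[R]_m -> 'rV[R]_n) : 1 <= c <= S ->
  C11_row setT H (N * c) (N * c ^+ 2) -> C11_row setT H (N * S) (N * S ^+ 2).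
Proof.
move=> /andP[c_ge1 cS]; have c_ge0 : 0 <= c by exact: le_trans c_ge1.
apply: C11_weaken; [exact: enorm_seminorm|exact: ler_wpM2l|].
by rewrite ler_wpM2l// lerXn2r ?nnegrE// (le_trans c_ge0).
Qed.

Let F_C11S : C11_row setT F (N * S) (N * S ^+ 2).
Proof. by apply: rescale F_C11; rewrite A_ge1 lerDl (le_trans ler01). Qed.

Let F_C11S' : C11_row setT F' (N * S) (N * S ^+ 2).
Proof. by apply: rescale F_C11'; rewrite A_ge1' lerDr (le_trans ler01). Qed.

Let h x := k (X x) (X' x) * dotv (F x) (F' x).

Lemma kernel_pairing_differentiable x : differentiable h x.
Proof.
exact: scaled_dotv_differentiable kernel_pairing_C11 F_C11S F_C11S' x.
Qed.

Lemma kernel_pairing_remainder_le x y :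
  `|h y - h x - 'D_(y - x) h x| <=
    b * (S ^+ 2 * (2 * (enorm (F x) + enorm (F' x) + enorm (F' y)) ^+ 2
                   + 2 * N ^+ 2)) * enorm (y - x) ^+ 2.
Proof.
apply: le_trans
  (scaled_dotv_remainder_le _ kernel_pairing_C11 F_C11S F_C11S' x y) _.
  by move=> z; exact: (psd_kernel_bound k_psd k_C2).
rewrite ler_wpM2r ?sqr_ge0//.
move: (enorm (F x)) (enorm (F' x)) (enorm (F' y))
  (enorm_ge0 (F x)) (enorm_ge0 (F' x)) (enorm_ge0 (F' y)) => p p' q p0 p'0 q0.
rewrite [leLHS](_ : _ =
    b * (S ^+ 2 * (2 * (p * p') + N * (2 * p + p' + q) + N ^+ 2)));
  last by ring.
rewrite ler_wpM2l// ler_wpM2l ?sqr_ge0//.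
have quadratic : 2 * (p * p') <= (p + p' + q) ^+ 2 by nra.
have linear : N * (2 * p + p' + q) <= 2 * (N * (p + p' + q)).
  by rewrite mulrCA ler_wpM2l//; lra.
have young : 2 * (N * (p + p' + q)) <= N ^+ 2 + (p + p' + q) ^+ 2.
  by have := sqr_ge0 (N - (p + p' + q)); nra.
by move: quadratic linear young; lra.
Qed.

End Kernel_pairing.

Section Reparametrization.
Context {R : realType}.
Variables (m d : nat) (mu sg : 'rV[R]_m -> 'rV[R]_d) (xi : 'rV[R]_d).
Variables (f : 'rV[R]_d -> R) (L M a b : R).

Definition reparam phi := mu phi + hadam (sg phi) xi.

Definition noisy_score phi := grad f (reparam phi) + ediv xi (sg phi).

Definition noisy_score_const := M + 2 * L + L * Num.sqrt L.

Hypothesis f_C3 : C3_bounded f L M.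
Hypothesis L_gt0 : 0 < L.
Hypotheses (mu_C2 : C2_bounded mu a) (sg_C2 : C2_bounded sg a).
Hypothesis sg_ge : forall phi i, (Num.sqrt L)^-1 <= sg phi 0 i.
Hypothesis xi_le : forall i, `|xi 0 i| <= b.
Hypotheses (a_ge1 : 1 <= a) (b_ge0 : 0 <= b).

Let A := a * (1 + b).
Let N := noisy_score_const.
Let semiE := @enorm_seminorm R.

Lemma reparam_C11 : C11_row setT reparam A A.
Proof.
have noise_C11 := C11_comp (semiE _) (semiE _) b_ge0 (lexx 0) (fun x _ => I)
  (C2_bounded_C11 sg_C2)
  (linear_C11 setT (semiE _) (hadam_linear xi) (hadam_le b_ge0 xi_le)).
apply: C11_weaken (C11D (semiE _) (C2_bounded_C11 mu_C2) noise_C11) => //.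
- by rewrite /A mulrDr mulr1 (mulrC b).
- by rewrite /A mulrDr mulr1 mul0r add0r (mulrC b).
Qed.

Lemma noisy_score_const_ge0 : 0 <= N.
Proof.
have [_ M_ge0] := C3_bounded_ge0 f_C3.
by rewrite /N /noisy_score_const !addr_ge0 ?mulr_ge0 ?sqrtr_ge0// ltW.
Qed.

Lemma noisy_score_C11 : C11_row setT noisy_score (N * A) (N * A ^+ 2).
Proof.
set r := Num.sqrt L; have r_gt0 : 0 < r by rewrite sqrtr_gt0.
have r_sqr : r ^+ 2 = L by rewrite sqr_sqrtr// ltW.
have [_ M_ge0] := C3_bounded_ge0 f_C3.
have grad_part := C11_comp (semiE _) (semiE _) (ltW L_gt0) M_ge0 (fun x _ => I)
  reparam_C11 (grad_C11 f_C3).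
have br_ge0 n : 0 <= b * r ^+ n by rewrite mulr_ge0// exprn_ge0// ltW.
have noise_part := C11_comp (semiE _) (semiE _) (br_ge0 2%N) (br_ge0 3%N)
  (fun phi _ => sg_ge phi)
  (C2_bounded_C11 sg_C2) (ediv_C11 b_ge0 xi_le r_gt0).
have A_ge1 : 1 <= A by rewrite /A; move: a_ge1 b_ge0; nra.
have A_ge0 : 0 <= A by exact: le_trans A_ge1.
have A_le_sqr : A <= A ^+ 2 by rewrite expr2 ler_peMl.
have ba_le : b * a <= A by rewrite /A; move: a_ge1; nra.
have ba2_le : b * a ^+ 2 <= A ^+ 2.
  by rewrite /A exprMn mulrC ler_wpM2l ?sqr_ge0//; move: b_ge0; nra.
have Lr_ge0 : 0 <= L * r by rewrite mulr_ge0// ltW.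
have LbaA := ler_wpM2l (ltW L_gt0) ba_le.
have LAA := ler_wpM2l (ltW L_gt0) A_le_sqr.
have LrbaA2 := ler_wpM2l Lr_ge0 ba2_le.
have MA_ge0 := mulr_ge0 M_ge0 A_ge0; have LrA_ge0 := mulr_ge0 Lr_ge0 A_ge0.
apply: C11_weaken (C11D (semiE _) grad_part noise_part) => //.
  rewrite [leLHS](_ : _ = L * A + L * (b * a)); last by rewrite r_sqr; ring.
  rewrite [leRHS](_ : _ = M * A + 2 * (L * A) + L * r * A); last first.
    by rewrite /N /noisy_score_const -/r; ring.
  lra.
rewrite [leLHS](_ : _ =
    M * A ^+ 2 + L * A + L * r * (b * a ^+ 2) + L * (b * a));
  last by rewrite [r ^+ 3]exprS r_sqr; ring.
rewrite [leRHS](_ : _ = M * A ^+ 2 + 2 * (L * A ^+ 2) + L * r * A ^+ 2);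
  last first.
  by rewrite /N /noisy_score_const -/r; ring.
lra.
Qed.

Lemma noisy_score_const_sqr_le : N ^+ 2 <= 15 * (M ^+ 2 + Num.max 1 L ^+ 3).
Proof.
have L_ge0 := ltW L_gt0; set Z := Num.max 1 L.
have [Z_ge1 L_leZ] : 1 <= Z /\ L <= Z by rewrite !le_max !lexx orbT.
have Z_ge0 : 0 <= Z by exact: le_trans Z_ge1.
have L3_le : L ^+ 3 <= Z ^+ 3 by rewrite lerXn2r.
have L2_le : L ^+ 2 <= Z ^+ 3.
  apply: (@le_trans _ _ (Z ^+ 2)); first by rewrite lerXn2r.
  by rewrite [leRHS]exprS ler_peMl ?sqr_ge0.
have cauchy x y z : (x + y + z) ^+ 2 <= 3 * (x ^+ 2 + y ^+ 2 + z ^+ 2) :> R.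
  by have := sqr_ge0 (x - y); have := sqr_ge0 (x - z); have := sqr_ge0 (y - z);
    nra.
apply: le_trans (cauchy _ _ _) _; rewrite !exprMn sqr_sqrtr// -exprSr.
by have := sqr_ge0 M; lra.
Qed.

End Reparametrization.

(** * Measurability *)

Section Measurable_continuous.
Context {R : realType} (dT : measure_display) (T : measurableType dT).

Lemma measurable_preimage_open (S : pseudoMetricType R) (D : countType)
    (c : D -> S) (g : T -> S) :
  (forall x e, 0 < e -> exists q, ball (c q) e x) ->
  (forall q e, measurable (g @^-1` ball (c q) e)) ->
  forall U, open U -> measurable (g @^-1` U).
Proof.
move=> c_dense mball U oU.
pose radius (j : nat) : R := j.+1%:R^-1.
have -> : g @^-1` U = \bigcup_(t in [set: D * nat])
    (if `[< ball (c t.1) (radius t.2) `<=` U >]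
     then g @^-1` ball (c t.1) (radius t.2) else set0).
  apply/seteqP; split => [w /= Ugw|w [t _]]; last first.
    by case: asboolP => // sub /sub.
  have /nbhs_ballP[e /= e0 eU] : nbhs (g w) U by exact: open_nbhs_nbhs.
  have e20 : 0 < e / 2 by rewrite divr_gt0.
  have [j /= je] := filter_ex (near_infty_natSinv_lt (PosNum e20)).
  have [q qw] : exists q, ball (c q) (radius j) (g w).
    by apply: c_dense; rewrite invr_gt0.
  exists (q, j) => //; case: asboolP => //= sub; exfalso; apply: sub => y qy.
  apply: eU; apply: (@ball_splitr _ _ (c q)); apply: le_ball (ltW je) _ _;
    last exact: qy.
  exact: qw.
apply: countable_bigcupT_measurable => [|t]; first exact: countableP.
by case: asboolP.
Qed.

Definition measurable_row n (g : T -> 'rV[R]_n) :=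
  forall i, measurable_fun setT (fun w => g w ord0 i).

Lemma measurable_preimage_ball n (g : T -> 'rV[R]_n) x e :
  measurable_row g -> measurable (g @^-1` ball x e).
Proof.
move=> mg; have [e0|e0] := leP e 0.
  rewrite (_ : _ @^-1` _ = set0)//.
  by apply/seteqP; split => // w [/= e0']; move: e0; rewrite leNgt e0'.
have -> : g @^-1` ball x e =
    \bigcap_(i in [set: 'I_n]) ((fun w => g w ord0 i) @^-1` ball (x 0 i) e).
  apply/seteqP; split => [w [_ gw] i _|w gw] /=; first exact: gw.
  by split => // i j; rewrite (ord1 i); exact: gw.
apply: fin_bigcap_measurable => // i _.
rewrite -[X in measurable X]setTI; apply: mg => //.
by apply: open_measurable; exact: ball_open.
Qed.

Lemma rat_row_dense n (x : 'rV[R]_n) e : 0 < e ->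
  exists q : 'rV[rat]_n, ball (map_mx ratr q : 'rV[R]_n) e x.
Proof.
move=> e0; have /choice[q qx] i : exists q : rat, `|ratr q - x 0 i| < e.
  have [q] := @rat_in_itvoo R (x 0 i - e) (x 0 i + e) ltac:(lra).
  by rewrite in_itv /= => /andP[q1 q2]; exists q; rewrite ltr_norml; lra.
exists (\row_i q i); split => // i j; rewrite !mxE (ord1 i) -ball_normE.
exact: qx.
Qed.

Lemma measurable_continuous_pair n p (f : 'rV[R]_n * 'rV[R]_p -> R)
    (g : T -> 'rV[R]_n) (h : T -> 'rV[R]_p) :
  continuous f -> measurable_row g -> measurable_row h ->
  measurable_fun setT (fun w => f (g w, h w)).
Proof.
move=> f_cts mg mh _.
apply: (measurability _ (RGenOInfty.measurableE R)) => // _ [_ [a ->] <-].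
rewrite setTI; pose q2r (q : 'rV[rat]_n * 'rV[rat]_p) : 'rV[R]_n * 'rV[R]_p :=
  (map_mx ratr q.1, map_mx ratr q.2).
apply: (@measurable_preimage_open _ _ q2r (fun w => (g w, h w)) _ _
  (f @^-1` `]a, +oo[)).
- move=> [x y] e e0; have [q qx] := rat_row_dense x e0.
  by have [r ry] := rat_row_dense y e0; exists (q, r).
- move=> q e; exact: measurableI (measurable_preimage_ball _ _ mg)
    (measurable_preimage_ball _ _ mh).
- by apply: open_comp => [x _|];
    [exact: f_cts|rewrite set_itvoy; exact: open_gt].
Qed.

Lemma measurable_continuous_row n (f : 'rV[R]_n -> R) (g : T -> 'rV[R]_n) :
  continuous f -> measurable_row g -> measurable_fun setT (fun w => f (g w)).
Proof.
move=> f_cts mg.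
apply: (measurable_continuous_pair (f := fun x => f x.1) _ mg mg).
by move=> x; apply: continuous_comp; [exact: cvg_fst|exact: f_cts].
Qed.

Lemma measurable_dotv n (g h : T -> 'rV[R]_n) :
  measurable_row g -> measurable_row h ->
  measurable_fun setT (fun w => dotv (g w) (h w)).
Proof. by move=> mg mh; apply: measurable_sum => i; exact: measurable_funM. Qed.

Lemma measurable_enorm n (g : T -> 'rV[R]_n) :
  measurable_row g -> measurable_fun setT (fun w => enorm (g w)).
Proof.
move=> mg; have msqrt := continuous_measurable_fun (@sqrt_continuous R).
exact: measurableT_comp msqrt (measurable_dotv mg mg).
Qed.

Lemma measurable_inv_ge0 (f : T -> R) : measurable_fun setT f ->
  (forall w, 0 <= f w) -> measurable_fun setT (fun w => (f w)^-1).
Proof.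
move=> mf f0; under eq_fun do rewrite -powR_inv1//.
exact: measurableT_comp (measurable_powR _) mf.
Qed.

End Measurable_continuous.

(** * Bounded means *)

Section Mean_bound.
Context {R : realType} (d : measure_display) (T : measurableType d).
Variable mu : {measure set T -> \bar R}.
Implicit Types (f g : T -> R) (a b c : R).

Definition mean_le f c := [/\ measurable_fun setT f, forall x, 0 <= f x
  & (\int[mu]_x (f x)%:E <= c%:E)%E].

Lemma mean_leD f g a b :
  mean_le f a -> mean_le g b -> mean_le (fun x => f x + g x) (a + b).
Proof.
move=> [mf f0 fa] [mg g0 gb]; split => [|x|].
- exact: measurable_funD.
- exact: addr_ge0.
under eq_integral do rewrite EFinD.
rewrite ge0_integralD//; first by rewrite EFinD leeD.
- by move=> x _; rewrite lee_fin.
- exact/measurable_EFinP.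
- by move=> x _; rewrite lee_fin.
- exact/measurable_EFinP.
Qed.

Lemma mean_leZ f a c : 0 <= c ->
  mean_le f a -> mean_le (fun x => c * f x) (c * a).
Proof.
move=> c0 [mf f0 fa]; split => [|x|].
- exact: measurable_funM.
- exact: mulr_ge0.
under eq_integral do rewrite EFinM.
rewrite ge0_integralZl//; first by rewrite EFinM lee_wpmul2l.
- exact/measurable_EFinP.
- by move=> x _; rewrite lee_fin.
Qed.

Lemma mean_le_weaken f a c : a <= c -> mean_le f a -> mean_le f c.
Proof. by move=> ac [mf f0 fa]; split; rewrite ?(le_trans fa)// lee_fin. Qed.

Lemma mean_le_dominated f g c : measurable_fun setT f ->
  (forall x, 0 <= f x) -> (forall x, f x <= g x) -> mean_le g c -> mean_le f c.
Proof.
move=> mf f0 fg [mg g0 gc]; split => //; apply: le_trans gc.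
by apply: ge0_le_integral => //;
  do ?[by move=> x _; rewrite lee_fin|exact/measurable_EFinP].
Qed.

Lemma mean_le_sum (I : Type) (s : seq I) (f : I -> T -> R) (a : I -> R) :
  (forall i, mean_le (f i) (a i)) ->
  mean_le (fun x => \sum_(i <- s) f i x) (\sum_(i <- s) a i).
Proof.
move=> fa; elim: s => [|i s IH].
  rewrite big_nil; split => [|x|].
    by under eq_fun do rewrite big_nil; exact: measurable_cst.
    by rewrite big_nil.
  by under eq_integral do rewrite big_nil; rewrite integral0.
rewrite big_cons; under eq_fun do rewrite big_cons; exact: mean_leD.
Qed.

(* Cauchy-Schwarz, by the weighted AM-GM inequality. *)
Lemma mean_leM f g a b : 0 < a -> 0 < b ->
  measurable_fun setT f -> measurable_fun setT g ->
  (forall x, 0 <= f x) -> (forall x, 0 <= g x) ->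
  mean_le (fun x => f x ^+ 2) (a ^+ 2) ->
  mean_le (fun x => g x ^+ 2) (b ^+ 2) ->
  mean_le (fun x => f x * g x) (a * b).
Proof.
move=> a0 b0 mf mg f0 g0 f2 g2.
have [p0 q0] : 0 <= b / (2 * a) /\ 0 <= a / (2 * b).
  by rewrite !divr_ge0 ?mulr_ge0 ?ltW.
have := mean_leD (mean_leZ p0 f2) (mean_leZ q0 g2).
have -> : b / (2 * a) * a ^+ 2 + a / (2 * b) * b ^+ 2 = a * b
  by field; rewrite !gt_eqF.
apply: mean_le_dominated => [|x|x]; [exact: measurable_funM|exact: mulr_ge0|].
rewrite -subr_ge0 [leRHS](_ : _ = (b * f x - a * g x) ^+ 2 / (2 * a * b));
  last first.
  by field; rewrite !gt_eqF.
by rewrite divr_ge0 ?sqr_ge0 ?mulr_ge0 ?ltW.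
Qed.

Lemma mean_le_integrable f c : mean_le f c -> mu.-integrable setT (EFin \o f).
Proof.
move=> [mf f0 fc]; apply/integrableP; split; first exact/measurable_EFinP.
rewrite (eq_integral (fun x => (f x)%:E)).
  exact: le_lt_trans fc (ltry _).
by move=> x _; rewrite gee0_abs// lee_fin.
Qed.

Lemma mean_le_Rintegral f c : mean_le f c -> \int[mu]_x f x <= c.
Proof.
move=> fc; have /integrable_fin_num fin := mean_le_integrable fc.
have [_ _ h] := fc; rewrite /Rintegral -lee_fin fineK//; exact: fin.
Qed.

End Mean_bound.

Lemma mean_le_image (R : realType) d1 d2 (T1 : measurableType d1)
    (T2 : measurableType d2) (mu : {measure set T1 -> \bar R})
    (nu : {measure set T2 -> \bar R}) (g : T1 -> T2) (f : T2 -> R) c :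
  measurable_fun setT g ->
  (forall A, measurable A -> mu (g @^-1` A) = nu A) ->
  mean_le nu f c -> mean_le mu (fun x => f (g x)) c.
Proof.
move=> mg law [mf f0 fc]; split => [||]; [exact: measurableT_comp|by []|].
pose gM : {mfun T1 >-> T2} := HB.pack g (isMeasurableFun.Build _ _ _ _ g mg).
have mfE : measurable_fun setT (EFin \o f) by exact/measurable_EFinP.
have fE0 : {in setT, forall y, (0 <= (EFin \o f) y)%E}
  by move=> y _; rewrite lee_fin.
have <- : (\int[pushforward mu gM]_y (f y)%:E = \int[mu]_x (f (g x))%:E)%E.
  by rewrite (ge0_integral_pushforward mg _ measurableT mfE fE0) preimage_setT.
by rewrite (eq_measure_integral nu)// => A mA _; exact: law.
Qed.

Section Product_space.
Context {R : realType} (d : measure_display) (T : measurableType d).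
Variable P : probability T R.

Lemma mean_le_cst c : 0 <= c -> mean_le P (fun=> c) c.
Proof.
move=> c0; split => //.
by rewrite integral_cst//= [X in (_ * X)%E]probability_setT mule1.
Qed.

Lemma mean_le_fst (f : T -> R) c : mean_le P f c ->
  mean_le (P \x P)%E (fun w => f w.1) c.
Proof.
apply: mean_le_image => // A mA; rewrite -setXT [LHS]product_measure1E//.
by rewrite [X in (_ * X)%E]probability_setT mule1.
Qed.

Lemma mean_le_snd (f : T -> R) c : mean_le P f c ->
  mean_le (P \x P)%E (fun w => f w.2) c.
Proof.
apply: mean_le_image => // A mA; rewrite -setTX [LHS]product_measure1E//.
by rewrite [X in (X * _)%E]probability_setT mul1e.
Qed.

End Product_space.

Section Smooth_expectation.
Context {R : realType} (d : measure_display) (T : measurableType d).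
Variable mu : {measure set T -> \bar R}.
Variables (m : nat) (h : 'rV[R]_m -> T -> R).
Variables (Lam : 'rV[R]_m -> 'rV[R]_m -> T -> R) (Q : R).
Hypothesis h_int : forall x, mu.-integrable setT (EFin \o h x).
Hypothesis h_diff : forall w x, differentiable (h ^~ w) x.
Hypothesis h_rem : forall x y w,
  `|h y w - h x w - 'D_(y - x) (h ^~ w) x| <= Lam x y w * enorm (y - x) ^+ 2.
Hypothesis Lam_mean : forall x y, mean_le mu (Lam x y) Q.

Let dh x v w := 'D_v (h ^~ w) x.

Let measurable_h x : measurable_fun setT (h x).
Proof. by apply/measurable_EFinP; exact: measurable_int (h_int x). Qed.

Let measurable_dh x v : measurable_fun setT (dh x v).
Proof.
apply: (@measurable_fun_cvg _ _ _ setT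
  (fun n w => (harmonic n)^-1 * (h (harmonic n *: v + x) w - h x w)))
  => [n|w _].
  by apply: measurable_funM => //; exact: measurable_funB.
have := diff_derivable (v := v) (h_diff w x).
rewrite /derivable /= => /cvgr_dnbhsP.
by apply; split => [n|]; [rewrite gt_eqF//|exact: cvg_harmonic].
Qed.

Let integrable_dh x v : mu.-integrable setT (EFin \o dh x v).
Proof.
have Lam_int :=
  mean_le_integrable (mean_leZ (sqr_ge0 (enorm v)) (Lam_mean x (x + v))).
have := integrableD measurableT (integrableD measurableT
  (integrable_norm (h_int (x + v))) (integrable_norm (h_int x))) Lam_int.
apply: le_integrable => //; first exact/measurable_EFinP/measurable_dh.
move=> w _; rewrite /= lee_fin; apply: le_trans (ler_norm _).
rewrite /dh -[X in `|X|](subKr (h (x + v) w - h x w)).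
apply: le_trans (ler_normB _ _) (lerD (ler_normB _ _) _).
by have := h_rem x (x + v) w; rewrite [x + v - x]addrAC subrr add0r mulrC.
Qed.

Let mean_dh x v := \int[mu]_w dh x v w.

Let mean_dh_linear x : linear (mean_dh x).
Proof.
move=> a u v; rewrite -[RHS]/(a * mean_dh x u + mean_dh x v) /mean_dh.
rewrite -RintegralZl// -RintegralD//.
  by apply: eq_Rintegral => w _; exact: derive_linear.
exact: (integrableZl measurableT a (integrable_dh x u)).
Qed.

Lemma Rintegral_lipschitz_grad (f := fun x => \int[mu]_w h x w) : 0 <= Q ->
  (forall x, differentiable f x) /\
  (forall x y, enorm (grad f x - grad f y) <= 6 * Q * enorm (x - y)).
Proof.
move=> Q0.
have f_rem x y : `|f y - f x - mean_dh x (y - x)| <= Q * enorm (y - x) ^+ 2.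
  have rem_int : mu.-integrable setT
      (EFin \o (fun w => h y w - h x w - dh x (y - x) w)).
    have := integrableB measurableT
      (integrableB measurableT (h_int y) (h_int x)) (integrable_dh x (y - x)).
    exact.
  have -> : f y - f x - mean_dh x (y - x)
      = \int[mu]_w (h y w - h x w - dh x (y - x) w).
    rewrite RintegralB//; first by rewrite RintegralB.
    exact: (integrableB measurableT (h_int y) (h_int x)).
  apply: le_trans (le_normr_Rintegral measurableT rem_int) _.
  have Lam_mean_xy := mean_leZ (sqr_ge0 (enorm (y - x))) (Lam_mean x y).
  rewrite mulrC; apply: le_trans (mean_le_Rintegral Lam_mean_xy).
  apply: le_Rintegral => //.
  - exact: integrable_norm rem_int.
  - exact: mean_le_integrable Lam_mean_xy.
  - by move=> w _; rewrite mulrC; exact: h_rem.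
have f_diff x := quadratic_remainder_is_diff (mean_dh_linear x) (f_rem x).
have f_derive x v : 'D_v f x = mean_dh x v
  by have [_ ->] := is_diff_is_derive v (f_diff x).
have df x : differentiable f x by have [] := f_diff x.
split=> // x y; apply: grad_lipschitz => // u w; rewrite f_derive; exact: f_rem.
Qed.

End Smooth_expectation.

(** * Independence *)

Section Independence.
Context {R : realType} (dO : measure_display) (Omega : measurableType dO).
Variable P : probability Omega R.

Lemma ge0_expectation_indepM (Z Y : Omega -> R) :
  measurable_fun setT Z -> measurable_fun setT Y ->
  (forall w, 0 <= Z w) -> (forall w, 0 <= Y w) ->
  (forall A C : set R, measurable A -> measurable C ->
    P (Z @^-1` A `&` Y @^-1` C) = (P (Z @^-1` A) * P (Y @^-1` C))%E) ->
  (\int[P]_w (Z w * Y w)%:E = \int[P]_w (Z w)%:E * \int[P]_w (Y w)%:E)%E.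
Proof.
move=> mZ mY Z0 Y0 indep.
pose Zr : {RV P >-> R} := HB.pack Z (isMeasurableFun.Build _ _ _ _ Z mZ).
pose Yr : {RV P >-> R} := HB.pack Y (isMeasurableFun.Build _ _ _ _ Y mY).
have mZY : measurable_fun setT (fun w => (Z w, Y w)).
  exact: measurable_fun_pair.
pose ZY : {RV P >-> (R * R)%type} := HB.pack (fun w => (Z w, Y w))
  (isMeasurableFun.Build _ _ _ _ (fun w => (Z w, Y w)) mZY).
pose F (xy : R * R) : \bar R := (`|xy.1|%:E * `|xy.2|%:E)%E.
have mF : measurable_fun setT F.
  by apply: emeasurable_funM; apply/measurable_EFinP/measurableT_comp.
have F0 xy : (0 <= F xy)%E by rewrite mule_ge0.
have mnormr : measurable_fun setT (fun y : R => `|y|%:E).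
  by apply/measurable_EFinP; exact: normr_measurable.
transitivity (\int[P]_w (F \o ZY) w)%E.
  by apply: eq_integral => w _; rewrite /F /= !ger0_norm.
rewrite -ge0_integral_distribution//.
transitivity (\int[(distribution P Zr \x distribution P Yr)%E]_xy F xy)%E.
  apply: eq_measure_integral => A mA _; apply/esym.
  by apply: product_measure_unique => // B C mB mC; exact: indep.
rewrite fubini_tonelli1//.
transitivity (\int[distribution P Zr]_x
    (`|x|%:E * \int[distribution P Yr]_y `|y|%:E))%E.
  by apply: eq_integral => x _; rewrite /fubini_F /F /= ge0_integralZl.
rewrite ge0_integralZr//; last by apply: integral_ge0.
rewrite !ge0_integral_distribution//.
by congr (_ * _)%E; apply: eq_integral => w _ /=; rewrite ger0_norm.
Qed.

Definition rectangles n (z : Omega -> 'rV[R]_n) : set (set Omega) :=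
  [set E | exists2 A : 'I_n -> set R, (forall j, measurable (A j)) &
     E = [set w | forall j, A j (z w ord0 j)]].

Section Sigma_algebra_of_row.
Variables (n : nat) (z : Omega -> 'rV[R]_n).

Lemma rectangles_setI : setI_closed (rectangles z).
Proof.
move=> _ _ [A mA ->] [C mC ->]; exists (fun j => A j `&` C j).
  by move=> j; exact: measurableI.
by apply/seteqP; split => w /= => [[h1 h2] j|h];
  [split|split => j; case: (h j)].
Qed.

Lemma rectanglesT : rectangles z setT.
Proof. by exists (fun _ => setT) => //; apply/seteqP; split. Qed.

Lemma measurable_row_rectangles :
  measurable_row (T := g_sigma_algebraType (rectangles z)) z.
Proof.
move=> j _ A mA; rewrite setTI; apply: sub_sigma_algebra.
exists (fun i => if i == j then A else setT); first by move=> i; case: ifP.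
apply/seteqP; split => w /= => [h i|/(_ j)]; last by rewrite eqxx.
by case: eqP => // ->.
Qed.

Hypothesis mz : measurable_row z.

Lemma rectangles_measurable : rectangles z `<=` measurable.
Proof.
move=> _ [A mA ->].
have -> : [set w | forall j, A j (z w ord0 j)] =
    \bigcap_(j in [set: 'I_n]) ((fun w => z w ord0 j) @^-1` A j).
  by apply/seteqP; split => w /= h j; [move=> _; exact: h|exact: h j I].
apply: fin_bigcap_measurable => // j _.
by rewrite -[X in measurable X]setTI; exact: mz.
Qed.

Lemma sigma_rectangles_measurable : <<s rectangles z >> `<=` measurable.
Proof.
apply: smallest_sub; last exact: rectangles_measurable.
exact: sigma_algebra_measurable.
Qed.

Lemma sigma_rectangles_indep H : measurable H ->
  (forall E, rectangles z E -> P (E `&` H) = (P E * P H)%E) ->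
  forall E, <<s rectangles z >> E -> P (E `&` H) = (P E * P H)%E.
Proof.
move=> mH indep E sE.
have PH_ge0 : 0 <= fine (P H) by rewrite fine_ge0.
have scaleE A : (P A * P H)%E = mscale (NngNum PH_ge0) P A.
  by rewrite /mscale /= fineK ?fin_num_measure// muleC.
rewrite scaleE; apply: (@g_sigma_algebra_measure_unique _ _ _ (rectangles z)
  rectangles_measurable (fun=> setT) (fun=> rectanglesT) _
  (mrestr P mH) (mscale (NngNum PH_ge0) P)) sE.
- by rewrite bigcup_const//; exists 0.
- exact: rectangles_setI.
- by move=> A rA; transitivity (P A * P H)%E; [exact: indep|exact: scaleE].
- move=> _; change (P (setT `&` H) < +oo)%E.
  by rewrite setTI ltey_eq fin_num_measure.
Qed.

End Sigma_algebra_of_row.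

Lemma rectangles_indep_prod n p (z : Omega -> 'rV[R]_n)
    (xi : Omega -> 'rV[R]_p) :
  (forall (A : 'I_n -> set R) (C : 'I_p -> set R),
    (forall j, measurable (A j)) -> (forall i, measurable (C i)) ->
    P ([set w | forall j, A j (z w ord0 j)]
       `&` [set w | forall i, C i (xi w ord0 i)])
    = (P [set w | forall j, A j (z w ord0 j)] *
       \prod_(i < p) P ((fun w => xi w ord0 i) @^-1` C i))%E) ->
  forall E H, rectangles z E -> rectangles xi H -> P (E `&` H) = (P E * P H)%E.
Proof.
move=> indep _ _ [A mA ->] [C mC ->]; rewrite indep//; congr (_ * _)%E.
have := indep (fun=> setT) C (fun=> measurableT) mC.
have -> : [set w | forall j : 'I_n, [set: R] (z w ord0 j)] = setT
  by apply/seteqP; split.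
by rewrite setTI probability_setT mul1e.
Qed.

Lemma mean_leM_indep n p (z : Omega -> 'rV[R]_n) (xi : Omega -> 'rV[R]_p)
    (Z Y : Omega -> R) a b :
  measurable_row z -> measurable_row xi ->
  (forall E H, rectangles z E -> rectangles xi H ->
    P (E `&` H) = (P E * P H)%E) ->
  measurable_fun [set: g_sigma_algebraType (rectangles z)] Z ->
  measurable_fun [set: g_sigma_algebraType (rectangles xi)] Y ->
  mean_le P Z a -> mean_le P Y b -> mean_le P (fun w => Z w * Y w) (a * b).
Proof.
move=> mz mxi indep mZz mYxi [mZ Z0 Za] [mY Y0 Yb].
have sigma_indep E H : <<s rectangles z >> E -> <<s rectangles xi >> H ->
    P (E `&` H) = (P E * P H)%E.
  move=> sE sH; rewrite setIC muleC.
  have mE := sigma_rectangles_measurable mz sE.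
  apply: (sigma_rectangles_indep mxi mE) sH => F rF.
  rewrite setIC muleC.
  apply: (sigma_rectangles_indep mz (rectangles_measurable mxi rF)) sE => G rG.
  exact: indep.
split => [|w|]; [exact: measurable_funM|exact: mulr_ge0|].
rewrite ge0_expectation_indepM//.
  rewrite EFinM lee_pmul//; by apply: integral_ge0 => w _; rewrite lee_fin.
move=> A C mA mC; apply: sigma_indep.
  by have := mZz measurableT A mA; rewrite setTI.
by have := mYxi measurableT C mC; rewrite setTI.
Qed.

End Independence.

(** * Gaussian moments *)

Section Gaussian_moment.
Context {R : realType}.
Local Notation mu := (@lebesgue_measure R).

Lemma ge0_integral_normal_prob (m s : R) (f : _ -> \bar R) :
  measurable_fun setT f -> (forall x, 0 <= f x)%E ->
  (\int[normal_prob m s]_x f x = \int[mu]_x (f x * (normal_pdf m s x)%:E))%E.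
Proof.
move=> mf f0; have dom := normal_prob_dominates m s.
rewrite -(Radon_Nikodym_SigmaFinite.change_of_variables dom)//.
have mpdf : measurable_fun setT (fun x => (normal_pdf m s x)%:E).
  by apply/measurable_EFinP; exact: measurable_normal_pdf.
have rn_int := Radon_Nikodym_SigmaFinite.f_integrable dom.
have rn_meas := measurable_int _ rn_int.
apply: ae_eq_integral => //; try exact: emeasurable_funM.
apply: ae_eqe_mul2l; apply: integral_ae_eq => // E _ mE.
by rewrite -Radon_Nikodym_SigmaFinite.f_integral.
Qed.

Lemma measurable_expR_sqr (c : R) :
  measurable_fun setT (fun x : R => expR (c * x ^+ 2)).
Proof. by apply: measurableT_comp => //; exact: measurable_funM. Qed.

Lemma normal_pdf_tilt (s x : R) : 0 < s ->
  expR ((1 - s ^- 2) / 2 * x ^+ 2) * normal_pdf 0 1 x = s * normal_pdf 0 s x.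
Proof.
move=> s0; rewrite normal_pdfE ?oner_neq0// normal_pdfE ?gt_eqF//.
rewrite /normal_peak /normal_fun subr0 expr1n mul1r.
have -> : Num.sqrt (s ^+ 2 * pi *+ 2) = s * Num.sqrt (pi *+ 2) :> R.
  by rewrite -mulrnAr sqrtrM ?sqr_ge0// sqrtr_sqr gtr0_norm.
have peak_neq0 : Num.sqrt (pi *+ 2) != 0 :> R.
  by rewrite gt_eqF// sqrtr_gt0 mulrn_wgt0// pi_gt0.
rewrite mulrCA -expRD [RHS]mulrA [s / _](_ : _ = (Num.sqrt (pi *+ 2))^-1);
  last first.
  by field; rewrite peak_neq0 gt_eqF.
congr (_ * expR _).
by rewrite -(mulr_natr _ 2); field; rewrite gt_eqF.
Qed.

Lemma integral_normal_expR_sqr (s : R) : 0 < s ->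
  (\int[@normal_prob R 0 1]_x (expR ((1 - s ^- 2) / 2 * x ^+ 2))%:E = s%:E)%E.
Proof.
move=> s0; rewrite ge0_integral_normal_prob; last 2 first.
- by apply/measurable_EFinP; exact: measurable_expR_sqr.
- by move=> x; rewrite lee_fin expR_ge0.
under eq_integral do rewrite -EFinM normal_pdf_tilt// EFinM.
rewrite ge0_integralZl//=.
- by rewrite integral_normal_pdf mule1.
- by apply/measurable_EFinP; exact: measurable_normal_pdf.
- by move=> x _; rewrite lee_fin normal_pdf_ge0.
- by rewrite lee_fin ltW.
Qed.

End Gaussian_moment.

Section Noise_energy.
Context {R : realType}.

Lemma expr4_ge0 (x : R) : 0 <= x ^+ 4.
Proof. by rewrite (exprM _ 2 2) sqr_ge0. Qed.

Lemma expr4D_le (x y : R) : (x + y) ^+ 4 <= 8 * (x ^+ 4 + y ^+ 4).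
Proof.
have sqrD_le (p q : R) : (p + q) ^+ 2 <= 2 * (p ^+ 2 + q ^+ 2).
  by have := sqr_ge0 (p - q); nra.
rewrite !(exprM _ 2 2).
apply: (@le_trans _ _ ((2 * (x ^+ 2 + y ^+ 2)) ^+ 2)).
  by rewrite lerXn2r ?nnegrE ?sqr_ge0 ?mulr_ge0 ?addr_ge0 ?sqr_ge0.
by rewrite exprMn; have := sqrD_le (x ^+ 2) (y ^+ 2); lra.
Qed.

Lemma expr4D4_le (x y p q : R) :
  (x + y + p + q) ^+ 4 <= 64 * (x ^+ 4 + y ^+ 4 + p ^+ 4 + q ^+ 4).
Proof.
have xypq := expr4D_le (x + y) (p + q); rewrite addrA in xypq.
by have := expr4D_le x y; have := expr4D_le p q; lra.
Qed.

Variable d : nat.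
Hypothesis d_gt0 : (0 < d)%N.
Implicit Types x : 'rV[R]_d.

(* The exponent 3/8 makes the Gaussian mean of each term equal to 2. *)
Definition noise_energy x : R :=
  d%:R^-1 * \sum_(i < d) expR (3 / 8 * x 0 i ^+ 2).

Let dR_gt0 : 0 < d%:R :> R. Proof. by rewrite ltr0n. Qed.

Lemma noise_energy_coord x i :
  expR (3 / 8 * x 0 i ^+ 2) <= d%:R * noise_energy x.
Proof.
rewrite /noise_energy mulVKf ?gt_eqF// (bigD1 i)//= lerDl.
by apply: sumr_ge0 => j _; exact: expR_ge0.
Qed.

Lemma noise_energy_gt0 x : 0 < noise_energy x.
Proof.
rewrite -(pmulr_rgt0 _ dR_gt0).
by apply: lt_le_trans (noise_energy_coord x (Ordinal d_gt0)); exact: expR_gt0.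
Qed.

(* The largest of [d] Gaussian coordinates is of order [sqrt (ln d)]. *)
Definition sup_noise_bound x : R :=
  1 + 32 * ln d%:R ^+ 2 + 128 * noise_energy x.

Lemma mx_norm4_le_sup_noise_bound x : (1 + `|x|) ^+ 4 <= 8 * sup_noise_bound x.
Proof.
set Y := noise_energy x; have Y_gt0 : 0 < Y by exact: noise_energy_gt0.
set l : R := ln d%:R; have l_ge0 : 0 <= l by rewrite ln_ge0// ler1n.
set r := Num.sqrt Y; have r_gt0 : 0 < r by rewrite sqrtr_gt0.
have r_sqr : r ^+ 2 = Y by rewrite sqr_sqrtr// ltW.
have lnY_le : ln Y <= 2 * r.
  by rewrite -r_sqr lnXn// mulr2n; have := ln_sublinear r_gt0; lra.
have x_sqr_le : `|x| ^+ 2 <= 4 * (l + 2 * r).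
  have [i ->] := mx_norm_eq_coord x d_gt0; rewrite real_normK ?num_real//.
  have : 3 / 8 * x 0 i ^+ 2 <= l + ln Y.
    rewrite -lnM ?posrE// -ler_expR lnK ?posrE; last exact: mulr_gt0.
    exact: noise_energy_coord.
  by move: (x 0 i ^+ 2) => t; lra.
have x_pow4_le : `|x| ^+ 4 <= (4 * (l + 2 * r)) ^+ 2.
  by rewrite (exprM _ 2 2) lerXn2r ?nnegrE ?sqr_ge0//; lra.
apply: le_trans (expr4D_le _ _) _.
rewrite expr1n ler_pM2l// /sup_noise_bound -/l -/Y -addrA lerD2l.
by apply: le_trans x_pow4_le _; rewrite -r_sqr; have := sqr_ge0 (l - 2 * r);
  nra.
Qed.

Lemma enorm4_le_noise_energy x :
  enorm x ^+ 4 <= 15 * d%:R ^+ 2 * noise_energy x.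
Proof.
pose squares : 'rV[R]_d := \row_i x 0 i ^+ 2; pose one : 'rV[R]_d := const_mx 1.
have -> : enorm x ^+ 4 = dotv squares one ^+ 2.
  rewrite (exprM _ 2 2) sqr_enorm; congr (_ ^+ 2).
  by apply: eq_bigr => i _; rewrite !mxE mulr1 expr2.
apply: le_trans (dotv_sqr_le squares one) _.
have -> : dotv one one = d%:R.
  by rewrite /dotv (eq_bigr (fun=> 1)) ?sumr_const ?card_ord// => i _;
    rewrite !mxE mulr1.
have -> : 15 * d%:R ^+ 2 * noise_energy x =
    (15 * \sum_(i < d) expR (3 / 8 * x 0 i ^+ 2)) * d%:R.
  by rewrite /noise_energy; field; rewrite gt_eqF.
rewrite ler_pM2r// mulr_sumr; apply: ler_sum => i _; rewrite !mxE.
have := @expR_ge1Dxn R (3 / 8 * x 0 i ^+ 2) 1.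
rewrite mulr_ge0 ?sqr_ge0 ?divr_ge0// => /(_ isT).
rewrite (_ : 2`! = 2)%N// -expr2; set t := x 0 i ^+ 2; move: (expR _) => e.
by have := sqr_ge0 t; lra.
Qed.

End Noise_energy.

Section Noise_moments.
Context {R : realType} (dO : measure_display) (Omega : measurableType dO).
Variables (P : probability Omega R) (d : nat) (xi : Omega -> 'rV[R]_d).
Hypothesis d_gt0 : (0 < d)%N.
Hypothesis mxi : measurable_row xi.

Definition standard_normal_row := forall i (A : set R), measurable A ->
  P ((fun w => xi w ord0 i) @^-1` A) = normal_prob 0 1 A.

Hypothesis law_xi : standard_normal_row.

Lemma noise_energy_mean : mean_le P (fun w => noise_energy (xi w)) 2.
Proof.
have coord_mean i : mean_le P (fun w => expR (3 / 8 * xi w 0 i ^+ 2)) 2.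
  apply: (@mean_le_image R _ _ _ (measurableTypeR R) P (normal_prob 0 1)
    (fun w => xi w 0 i) (fun x => expR (3 / 8 * x ^+ 2)) _ (mxi i) (law_xi i)).
  split => [|x|]; [exact: measurable_expR_sqr|exact: expR_ge0|].
  have -> : 3 / 8 = (1 - 2 ^- 2) / 2 :> R by field.
  by rewrite integral_normal_expR_sqr.
have -> : 2 = d%:R^-1 * \sum_(i < d) 2 :> R.
  rewrite sumr_const card_ord -[2 *+ d]mulr_natl mulrA.
  by rewrite mulVf ?mul1r ?pnatr_eq0 -?lt0n.
by apply: mean_leZ; [rewrite invr_ge0|exact: mean_le_sum].
Qed.

Lemma sup_noise_bound_mean :
  mean_le P (fun w => sup_noise_bound (xi w)) (257 + 32 * ln d%:R ^+ 2).
Proof.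
have cst_ge0 : 0 <= 1 + 32 * ln d%:R ^+ 2 :> R.
  by rewrite addr_ge0// mulr_ge0// sqr_ge0.
have -> : 257 + 32 * ln d%:R ^+ 2 = 1 + 32 * ln d%:R ^+ 2 + 128 * 2 :> R
  by ring.
exact: mean_leD (mean_le_cst P cst_ge0)
  (mean_leZ (ler0n R 128) noise_energy_mean).
Qed.

Lemma measurable_sup_noise_bound dT (T : measurableType dT)
    (x : T -> 'rV[R]_d) :
  measurable_row x -> measurable_fun setT (fun w => sup_noise_bound (x w)).
Proof.
move=> mx; apply: measurable_funD => //; apply: measurable_funM => //.
apply: measurable_funM => //; apply: measurable_sum => i.
exact: measurableT_comp (measurable_expR_sqr _) (mx i).
Qed.

End Noise_moments.

Section Reparam_moment.
Context {R : realType} (dO : measure_display) (Omega : measurableType dO).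
Variables (P : probability Omega R) (d dz : nat).
Variables (z : Omega -> 'rV[R]_dz) (xi : Omega -> 'rV[R]_d) (c1 G : R).
Hypotheses (d_ge2 : (2 <= d)%N) (dz_ge1 : (1 <= dz)%N) (c1_gt0 : 0 < c1).
Hypotheses (mz : measurable_row z) (mxi : measurable_row xi).
Hypothesis law_xi : standard_normal_row P xi.
Hypothesis indep : forall E H, rectangles z E -> rectangles xi H ->
  P (E `&` H) = (P E * P H)%E.
Hypothesis z_moment :
  (\int[P]_w (enorm (z w) ^+ 4)%:E <= (c1 * dz%:R ^+ 2)%:E)%E.

Definition reparam_lip w : R := G * (1 + enorm (z w)) * (1 + `|xi w|).

Let d_gt0 : (0 < d)%N. Proof. exact: ltnW. Qed.

Lemma measurable_reparam_lip : measurable_fun setT reparam_lip.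
Proof.
have menorm_z := measurable_enorm mz.
have mnorm_xi := measurable_continuous_row (@norm_continuous _ 'rV[R]_d) mxi.
by apply: measurable_funM; [apply: measurable_funM => //|];
  exact: measurable_funD.
Qed.

Lemma reparam_lip4_le w : reparam_lip w ^+ 4
  <= 64 * G ^+ 4 * ((1 + enorm (z w) ^+ 4) * sup_noise_bound (xi w)).
Proof.
have z_le := expr4D_le 1 (enorm (z w)); rewrite expr1n in z_le.
have xi_le := mx_norm4_le_sup_noise_bound d_gt0 (xi w).
rewrite /reparam_lip !exprMn -mulrA [leRHS](_ : _ = G ^+ 4 *
  (8 * (1 + enorm (z w) ^+ 4) * (8 * sup_noise_bound (xi w)))); last by ring.
by rewrite ler_wpM2l ?expr4_ge0// ler_pM ?expr4_ge0.
Qed.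

Definition reparam_lip_const : R := 64 * (1 + c1) * (32 + 257 / ln 2 ^+ 2).

Lemma reparam_lip_const_gt0 : 0 < reparam_lip_const.
Proof.
apply: mulr_gt0; first by apply: mulr_gt0 (ltr0Sn _ _) (addr_gt0 ltr01 c1_gt0).
exact: ltr_wpDr (divr_ge0 (ler0n _ _) (sqr_ge0 _)) (ltr0Sn _ _).
Qed.

Let moment_const_le :
  (1 + c1 * dz%:R ^+ 2) * (257 + 32 * ln d%:R ^+ 2)
    <= (1 + c1) * dz%:R ^+ 2 * ((32 + 257 / ln 2 ^+ 2) * ln d%:R ^+ 2).
Proof.
have ln2_gt0 : 0 < ln 2 :> R by rewrite ln_gt0// ltr1n.
have ln2_le : ln 2 <= ln d%:R :> R by rewrite ler_ln ?posrE ?ltr0n// ler_nat.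
have ln_ratio : 1 <= ln d%:R ^+ 2 / ln 2 ^+ 2 :> R.
  have lnd_ge0 := le_trans (ltW ln2_gt0) ln2_le.
  by rewrite ler_pdivlMr ?exprn_gt0// mul1r lerXn2r ?nnegrE// ltW.
apply: ler_pM.
- by rewrite addr_ge0// mulr_ge0 ?sqr_ge0// ltW.
- by apply: addr_ge0 (ler0n _ _) (mulr_ge0 (ler0n _ _) (sqr_ge0 _)).
- by rewrite mulrDl mul1r lerD2r -[leLHS](expr1n _ 2) lerXn2r ?nnegrE// ler1n.
rewrite [leRHS](_ : _ = 257 * (ln d%:R ^+ 2 / ln 2 ^+ 2) + 32 * ln d%:R ^+ 2);
  last by ring.
by rewrite lerD2r; move: (_ / _) ln_ratio => q; lra.
Qed.

Lemma reparam_lip4_mean : mean_le P (fun w => reparam_lip w ^+ 4)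
  (reparam_lip_const * (G ^+ 2 * dz%:R * ln d%:R) ^+ 2).
Proof.
have G4_ge0 : 0 <= 64 * G ^+ 4 := mulr_ge0 (ler0n _ _) (expr4_ge0 G).
have z_mean : mean_le P (fun w => 1 + enorm (z w) ^+ 4) (1 + c1 * dz%:R ^+ 2).
  apply: mean_leD; first exact: mean_le_cst.
  split => // [|w]; last exact: expr4_ge0.
  by apply: measurable_funX; exact: measurable_enorm.
have product_mean := mean_leM_indep mz mxi indep _ _ z_mean
  (sup_noise_bound_mean d_gt0 mxi law_xi).
have -> : reparam_lip_const * (G ^+ 2 * dz%:R * ln d%:R) ^+ 2 = 64 * G ^+ 4 *
    ((1 + c1) * dz%:R ^+ 2 * ((32 + 257 / ln 2 ^+ 2) * ln d%:R ^+ 2)).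
  by rewrite /reparam_lip_const; ring.
apply: mean_le_dominated (mean_leZ G4_ge0 (mean_le_weaken moment_const_le
  (product_mean _ _))) => [|w|w||].
- by apply: measurable_funX; exact: measurable_reparam_lip.
- exact: expr4_ge0.
- exact: reparam_lip4_le.
- apply: measurable_funD => //; apply: measurable_funX.
  exact: measurable_enorm (@measurable_row_rectangles _ _ _ _ z).
- exact: measurable_sup_noise_bound (@measurable_row_rectangles _ _ _ _ xi).
Qed.

End Reparam_moment.

Section Noisy_score_moment.
Context {R : realType} (dO : measure_display) (Omega : measurableType dO).
Variables (P : probability Omega R) (d : nat) (X S xi : Omega -> 'rV[R]_d).
Variables (f : 'rV[R]_d -> R) (L M s : R) (xstar : 'rV[R]_d).
Hypotheses (d_gt0 : (0 < d)%N) (L_gt0 : 0 < L) (f_C3 : C3_bounded f L M).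
Hypotheses (mX : measurable_row X) (mS : measurable_row S).
Hypothesis mxi : measurable_row xi.
Hypothesis law_xi : standard_normal_row P xi.
Hypothesis S_ge : forall w i, (Num.sqrt L)^-1 <= S w 0 i.
Hypothesis X_moment : (\int[P]_w ((enorm (X w)) ^+ 4)%:E <= (s ^+ 4)%:E)%E.

Let F w := grad f (X w) + ediv (xi w) (S w).
Let sqrtL_gt0 : 0 < Num.sqrt L. Proof. by rewrite sqrtr_gt0. Qed.

Lemma measurable_score_plus_noise : measurable_row F.
Proof.
move=> i; have -> : (fun w => F w ord0 i) =
    (fun w => 'D_(evec i) f (X w) + xi w ord0 i * (S w ord0 i)^-1).
  by apply/funext => w; rewrite [LHS]mxE; congr (_ + _); rewrite mxE.
apply: measurable_funD.
  apply: (measurable_continuous_row (f := 'D_(evec i) f) _ mX) => x.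
  apply: differentiable_continuous.
  by have [[_ [ddf _]] _] := f_C3; exact: ddf.
apply: measurable_funM => //; apply: measurable_inv_ge0 => // w.
by apply: le_trans (S_ge w i); rewrite invr_ge0 ltW.
Qed.

Lemma score_plus_noise_le w : enorm (F w) <= enorm (grad f xstar)
  + L * enorm xstar + L * enorm (X w) + Num.sqrt L * enorm (xi w).
Proof.
apply: le_trans (enormD _ _) (lerD _ (ediv_le _ sqrtL_gt0 (S_ge w))).
have [D [_ _ grad_inc _]] := grad_C11 f_C3.
rewrite -[grad f (X w)](subrKC (grad f xstar)) -addrA -mulrDr.
apply: le_trans (enormD _ _) _; rewrite lerD2l.
apply: le_trans (grad_inc xstar (X w) I I) _; rewrite ler_wpM2l ?(ltW L_gt0)//.
by apply: le_trans (enormD _ _) _; rewrite enormN addrC.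
Qed.

Lemma score_plus_noise4_mean : mean_le P (fun w => enorm (F w) ^+ 4)
  (64 * (enorm (grad f xstar) ^+ 4 + (L * enorm xstar) ^+ 4 + L ^+ 4 * s ^+ 4
         + L ^+ 2 * (15 * d%:R ^+ 2 * 2))).
Proof.
have const_ge0 : 0 <= enorm (grad f xstar) ^+ 4 + (L * enorm xstar) ^+ 4.
  by rewrite addr_ge0 ?expr4_ge0.
have X_mean : mean_le P (fun w => enorm (X w) ^+ 4) (s ^+ 4).
  split => // [|w]; last exact: expr4_ge0.
  by apply: measurable_funX; exact: measurable_enorm.
have xi_coef : 0 <= 15 * d%:R ^+ 2 :> R by rewrite mulr_ge0 ?sqr_ge0.
have xi_mean :=
  mean_leZ (sqr_ge0 L) (mean_leZ xi_coef (noise_energy_mean d_gt0 mxi law_xi)).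
have X_xi_mean := mean_leD (mean_leD (mean_le_cst P const_ge0)
  (mean_leZ (expr4_ge0 L) X_mean)) xi_mean.
apply: mean_le_dominated (mean_leZ (ler0n R 64) X_xi_mean) => [|w|w].
- by apply: measurable_funX; apply: measurable_enorm;
    exact: measurable_score_plus_noise.
- exact: expr4_ge0.
apply: (@le_trans _ _ ((enorm (grad f xstar) + L * enorm xstar + L * enorm (X w)
    + Num.sqrt L * enorm (xi w)) ^+ 4)).
  rewrite lerXn2r ?nnegrE ?enorm_ge0 ?score_plus_noise_le//.
  by apply: le_trans (score_plus_noise_le w); exact: enorm_ge0.
apply: le_trans (expr4D4_le _ _ _ _) _; rewrite ler_pM2l//; apply: lerD.
  by rewrite [(L * enorm (X w)) ^+ 4]exprMn.
rewrite [in leLHS]exprMn (exprM _ 2 2) sqr_sqrtr ?(ltW L_gt0)//.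
rewrite ler_wpM2l ?sqr_ge0//.
exact: enorm4_le_noise_energy.
Qed.

End Noisy_score_moment.

(** * Smoothness of the loss *)

Section Loss.
Context {R : realType}.
Variables (c1 c0 : R) (d dz m : nat) (dO : measure_display).
Variables (Omega : measurableType dO) (P : probability Omega R).
Variables (z : Omega -> 'rV[R]_dz) (xi : Omega -> 'rV[R]_d).
Variables (f : 'rV[R]_d -> R) (k : 'rV[R]_d -> 'rV[R]_d -> R).
Variables (mu sigma : 'rV[R]_dz -> 'rV[R]_m -> 'rV[R]_d).
Variables (B L M G s : R) (xstar : 'rV[R]_d).
Hypotheses (c1_gt0 : 0 < c1) (c0_gt0 : 0 < c0).
Hypotheses (d_ge2 : (2 <= d)%N) (dz_ge1 : (1 <= dz)%N).
Hypotheses (mz : measurable_row z) (mxi : measurable_row xi).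
Hypothesis law_xi : standard_normal_row P xi.
Hypothesis indep : forall E H, rectangles z E -> rectangles xi H ->
  P (E `&` H) = (P E * P H)%E.
Hypothesis mmu : forall phi, measurable_row (fun w => mu (z w) phi).
Hypothesis msigma : forall phi, measurable_row (fun w => sigma (z w) phi).
Hypotheses (k_psd : cont_psd_kernel k) (k_C2 : kernel_C2_bounded k (B ^+ 2)).
Hypotheses (L_gt0 : 0 < L) (f_C3 : C3_bounded f L M) (G_ge1 : 1 <= G).
Hypothesis mu_C2 : forall y, C2_bounded (mu y) (G * (1 + enorm y)).
Hypothesis sigma_C2 : forall y, C2_bounded (sigma y) (G * (1 + enorm y)).
Hypothesis sigma_ge : forall y phi i, (Num.sqrt L)^-1 <= sigma y phi 0 i.
Hypothesis z_moment :
  (\int[P]_w (enorm (z w) ^+ 4)%:E <= (c1 * dz%:R ^+ 2)%:E)%E.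
Hypothesis x_moment : forall phi,
  (\int[P]_w (enorm (xsample mu sigma phi (z w) (xi w)) ^+ 4)%:E
    <= (s ^+ 4)%:E)%E.

Let d_gt0 : (0 < d)%N. Proof. exact: ltnW. Qed.
Let X phi w := xsample mu sigma phi (z w) (xi w).
Let F phi w := grad f (X phi w) + ediv (xi w) (sigma (z w) phi).
Let A w := reparam_lip z xi G w.
Let N := noisy_score_const L M.

Let G_enorm_ge1 w : 1 <= G * (1 + enorm (z w)).
Proof.
rewrite (le_trans G_ge1)// ler_peMr ?lerDl ?enorm_ge0//.
exact: le_trans ler01 G_ge1.
Qed.

Let A_ge1 w : 1 <= A w.
Proof.
rewrite (le_trans (G_enorm_ge1 w))// ler_peMr ?lerDl//.
exact: le_trans ler01 (G_enorm_ge1 w).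
Qed.

Let X_C11 w : C11_row setT (X ^~ w) (A w) (A w).
Proof.
exact: (reparam_C11 (mu_C2 (z w)) (sigma_C2 (z w)) (coord_le_mx_norm (xi w))).
Qed.

Let F_C11 w : C11_row setT (F ^~ w) (N * A w) (N * A w ^+ 2).
Proof.
exact: (noisy_score_C11 f_C3 L_gt0 (mu_C2 (z w)) (sigma_C2 (z w))
  (sigma_ge (z w)) (coord_le_mx_norm (xi w)) (G_enorm_ge1 w)).
Qed.

Let measurable_X phi : measurable_row (X phi).
Proof.
move=> i; rewrite /X /xsample; under eq_fun do rewrite !mxE.
by apply: measurable_funD;
  [exact: mmu|apply: measurable_funM; [exact: msigma|]].
Qed.

Let measurable_F phi : measurable_row (F phi).
Proof.
exact: (measurable_score_plus_noise L_gt0 f_C3 (measurable_X phi) (msigma phi)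
  mxi (fun w => sigma_ge (z w) phi)).
Qed.

Let C := Num.sqrt (c0 * (L ^+ 4 * (s ^+ 4 + enorm xstar ^+ 4)
                         + enorm (grad f xstar) ^+ 4)).
Let scaleA : R := G ^+ 2 * dz%:R * ln d%:R.
Let scaleF : R := C + L * d%:R.
Let W : R := M ^+ 2 + Num.max 1 L ^+ 3.

Definition score_const : R := 64 * (c0^-1 + 30).

Lemma score4_mean phi :
  mean_le P (fun w => enorm (F phi w) ^+ 4) (score_const * scaleF ^+ 2).
Proof.
apply: mean_le_weaken
  (score_plus_noise4_mean xstar d_gt0 L_gt0 f_C3 (measurable_X phi)
  (msigma phi) mxi law_xi (fun w => sigma_ge (z w) phi) (x_moment phi)).
have inner_ge0 :
    0 <= L ^+ 4 * (s ^+ 4 + enorm xstar ^+ 4) + enorm (grad f xstar) ^+ 4.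
  exact: addr_ge0
    (mulr_ge0 (expr4_ge0 _) (addr_ge0 (expr4_ge0 _) (expr4_ge0 _)))
    (expr4_ge0 _).
have C_sqr : C ^+ 2 = c0 * (L ^+ 4 * (s ^+ 4 + enorm xstar ^+ 4)
    + enorm (grad f xstar) ^+ 4) by rewrite sqr_sqrtr// mulr_ge0// ltW.
rewrite [leLHS](_ : _ = 64 * (c0^-1 * C ^+ 2 + 30 * (L * d%:R) ^+ 2));
  last first.
  by rewrite C_sqr; field; rewrite gt_eqF.
have C_ge0 : 0 <= C by exact: sqrtr_ge0.
have Ld_ge0 : 0 <= L * d%:R by rewrite mulr_ge0// ltW.
have c0V_ge0 : 0 <= c0^-1 by rewrite invr_ge0 ltW.
have scaleF_ge0 : 0 <= scaleF by exact: addr_ge0.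
have C_sqr_le : C ^+ 2 <= scaleF ^+ 2 by rewrite lerXn2r ?nnegrE// lerDl.
have Ld_sqr_le : (L * d%:R) ^+ 2 <= scaleF ^+ 2
  by rewrite lerXn2r ?nnegrE// lerDr.
rewrite /score_const -mulrA ler_pM2l// [leRHS]mulrDl.
by apply: lerD; exact: ler_wpM2l.
Qed.

Let S (w : Omega * Omega) := A w.1 + A w.2.
Let energy phi psi (w : Omega * Omega) :=
  2 * (enorm (F phi w.1) + enorm (F phi w.2) + enorm (F psi w.2)) ^+ 2
  + 2 * N ^+ 2.

Let h phi (w : Omega * Omega) :=
  k (X phi w.1) (X phi w.2) * dotv (F phi w.1) (F phi w.2).

Let measurable_S : measurable_fun setT S.
Proof.
have mA := measurable_reparam_lip G mz mxi.
by apply: measurable_funD; exact: measurableT_comp.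
Qed.

Let measurable_energy phi psi : measurable_fun setT (energy phi psi).
Proof.
have mF1 eta : measurable_fun setT (fun w : Omega * Omega => enorm (F eta w.1)).
  exact: measurableT_comp (measurable_enorm (measurable_F eta)) measurable_fst.
have mF2 eta : measurable_fun setT (fun w : Omega * Omega => enorm (F eta w.2)).
  exact: measurableT_comp (measurable_enorm (measurable_F eta)) measurable_snd.
apply: measurable_funD => //; apply: measurable_funM => //.
apply: measurable_funX.
by apply: measurable_funD; [exact: measurable_funD|].
Qed.

Let measurable_h phi : measurable_fun setT (h phi).
Proof.
apply: measurable_funM.
  apply: (measurable_continuous_pair (f := fun x => k x.1 x.2)) => [|i|i].
  - by have [] := k_psd.
  - exact: measurableT_comp (measurable_X phi i) measurable_fst.
  - exact: measurableT_comp (measurable_X phi i) measurable_snd.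
apply: measurable_dotv => i.
- exact: measurableT_comp (measurable_F phi i) measurable_fst.
- exact: measurableT_comp (measurable_F phi i) measurable_snd.
Qed.

Let scaleA_gt0 : 0 < scaleA.
Proof.
rewrite !mulr_gt0 ?exprn_gt0 ?ltr0n ?ln_gt0 ?ltr1n//; exact: lt_le_trans G_ge1.
Qed.

Let scaleF_gt0 : 0 < scaleF.
Proof. by rewrite ltr_wpDl ?sqrtr_ge0// mulr_gt0 ?ltr0n. Qed.

Let W_ge0 : 0 <= W.
Proof. by rewrite addr_ge0 ?sqr_ge0 ?exprn_ge0// le_max ler01. Qed.

Let alpha := Num.sqrt (16 * reparam_lip_const c1).
Let beta := Num.sqrt (8 * (192 * score_const + 225)).

Definition smoothness_const := 6 * (alpha * beta).

Let score_const_ge0 : 0 <= score_const.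
Proof. by rewrite mulr_ge0// addr_ge0// invr_ge0 ltW. Qed.

Let alpha_gt0 : 0 < alpha.
Proof.
rewrite sqrtr_gt0; exact: mulr_gt0 (ltr0Sn _ _) (reparam_lip_const_gt0 c1_gt0).
Qed.

Let alpha_sqr : alpha ^+ 2 = 16 * reparam_lip_const c1.
Proof. by apply: sqr_sqrtr; move: alpha_gt0; rewrite sqrtr_gt0 => /ltW. Qed.

Let beta_gt0 : 0 < beta.
Proof.
rewrite sqrtr_gt0; apply: mulr_gt0 (ltr0Sn _ _) _.
exact: ltr_wpDl (mulr_ge0 (ler0n _ _) score_const_ge0) (ltr0Sn _ _).
Qed.

Let beta_sqr : beta ^+ 2 = 8 * (192 * score_const + 225).
Proof. by apply: sqr_sqrtr; move: beta_gt0; rewrite sqrtr_gt0 => /ltW. Qed.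

Let S_sqr_mean : mean_le (P \x P)%E (fun w => (S w ^+ 2) ^+ 2)
  ((alpha * scaleA) ^+ 2).
Proof.
have A_mean :=
  reparam_lip4_mean G d_ge2 dz_ge1 c1_gt0 mz mxi law_xi indep z_moment.
have -> : (alpha * scaleA) ^+ 2 = 8 * (reparam_lip_const c1 * scaleA ^+ 2
    + reparam_lip_const c1 * scaleA ^+ 2).
  by rewrite exprMn alpha_sqr; ring.
apply: mean_le_dominated (mean_leZ (ler0n R 8)
  (mean_leD (mean_le_fst A_mean) (mean_le_snd A_mean))) => [|w|w].
- by do 2![apply: measurable_funX].
- exact: sqr_ge0.
- by rewrite -exprM; exact: expr4D_le.
Qed.

Let energy_sqr_mean phi psi :
  mean_le (P \x P)%E (fun w => energy phi psi w ^+ 2)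
    ((beta * (scaleF + W)) ^+ 2).
Proof.
have W_sqr_ge0 : 0 <= 225 * W ^+ 2 := mulr_ge0 (ler0n _ _) (sqr_ge0 _).
have bound_mean := mean_leZ (ler0n R 8) (mean_leD
  (mean_leZ (ler0n R 64) (mean_leD (mean_leD (mean_le_fst (score4_mean phi))
     (mean_le_snd (score4_mean phi))) (mean_le_snd (score4_mean psi))))
  (mean_le_fst (mean_le_cst P W_sqr_ge0))).
have const_le : 8 * (64 * (score_const * scaleF ^+ 2 + score_const * scaleF ^+ 2
    + score_const * scaleF ^+ 2) + 225 * W ^+ 2) <= (beta * (scaleF + W)) ^+ 2.
  have F_ge0 := ltW scaleF_gt0; have FW_ge0 := addr_ge0 F_ge0 W_ge0.
  have F_sqr_le : scaleF ^+ 2 <= (scaleF + W) ^+ 2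
    by rewrite lerXn2r ?nnegrE// lerDl.
  have W_sqr_le : W ^+ 2 <= (scaleF + W) ^+ 2
    by rewrite lerXn2r ?nnegrE// lerDr.
  rewrite exprMn beta_sqr -[leRHS]mulrA; apply: (ler_wpM2l (ler0n _ 8)).
  rewrite [leRHS]mulrDl; apply: lerD;
    last exact: ler_wpM2l (ler0n _ _) _ _ W_sqr_le.
  rewrite [leLHS](_ : _ = 192 * score_const * scaleF ^+ 2); last by ring.
  exact: ler_wpM2l (mulr_ge0 (ler0n _ _) score_const_ge0) _ _ F_sqr_le.
apply: mean_le_dominated (mean_le_weaken const_le bound_mean) => [|w|w].
- exact: measurable_funX.
- exact: sqr_ge0.
rewrite /energy; set p := enorm _ + enorm _ + enorm _.
have p_pow4_le : p ^+ 4 <= 64 * (enorm (F phi w.1) ^+ 4 + enorm (F phi w.2) ^+ 4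
    + enorm (F psi w.2) ^+ 4).
  have := expr4D4_le (enorm (F phi w.1)) (enorm (F phi w.2))
    (enorm (F psi w.2)) 0.
  by rewrite expr0n !addr0.
have N_pow4_le : (N ^+ 2) ^+ 2 <= (15 * W) ^+ 2.
  by rewrite lerXn2r ?nnegrE ?sqr_ge0 ?mulr_ge0//;
    exact: noisy_score_const_sqr_le.
rewrite exprMn in N_pow4_le; have := sqr_ge0 (p ^+ 2 - N ^+ 2).
move: p_pow4_le; rewrite (exprM p 2 2);
  move: (p ^+ 2) (N ^+ 2) N_pow4_le => q n N_pow4_le p_pow4_le; nra.
Qed.

Let Lam phi psi w := B ^+ 2 * (S w ^+ 2 * energy phi psi w).
Let Q : R := B ^+ 2 * (alpha * scaleA * (beta * (scaleF + W))).

Let Lam_mean phi psi : mean_le (P \x P)%E (Lam phi psi) Q.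
Proof.
apply: (mean_leZ (sqr_ge0 B)); apply: mean_leM S_sqr_mean (energy_sqr_mean phi psi) => [||||w|w].
- by rewrite mulr_gt0.
- by rewrite mulr_gt0// ltr_wpDr.
- exact: measurable_funX measurable_S.
- exact: measurable_energy.
- exact: sqr_ge0.
- by apply: addr_ge0; exact: mulr_ge0 (ler0n _ _) (sqr_ge0 _).
Qed.

Let h_integrable phi : (P \x P)%E.-integrable setT (EFin \o h phi).
Proof.
have bound_mean := mean_leZ (sqr_ge0 B) (mean_leD
  (mean_leD (mean_le_fst (score4_mean phi)) (mean_le_snd (score4_mean phi)))
  (mean_le_fst (mean_le_cst P ler01))).
apply: le_integrable (mean_le_integrable bound_mean) => //.
  exact/measurable_EFinP.
move=> w _; rewrite /= lee_fin [leRHS]ger0_norm; last by case: bound_mean.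
rewrite normrM ler_pM ?(psd_kernel_bound k_psd k_C2)//.
apply: le_trans (cauchy_schwarz _ _) _.
move: (enorm _) (enorm _) => p q; rewrite !(exprM _ 2 2).
have := sqr_ge0 (p - q); have := sqr_ge0 (p ^+ 2 - 1).
by have := sqr_ge0 (q ^+ 2 - 1); nra.
Qed.

Let h_diff w phi : differentiable (h ^~ w) phi.
Proof.
exact: (kernel_pairing_differentiable k_psd k_C2 (A_ge1 w.1) (A_ge1 w.2)
  (noisy_score_const_ge0 f_C3 L_gt0) (X_C11 w.1) (X_C11 w.2)
  (F_C11 w.1) (F_C11 w.2)).
Qed.

Let h_rem phi psi w : `|h psi w - h phi w - 'D_(psi - phi) (h ^~ w) phi|
  <= Lam phi psi w * enorm (psi - phi) ^+ 2.
Proof.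
exact: (kernel_pairing_remainder_le k_psd k_C2 (A_ge1 w.1) (A_ge1 w.2)
  (noisy_score_const_ge0 f_C3 L_gt0) (X_C11 w.1) (X_C11 w.2)
  (F_C11 w.1) (F_C11 w.2)).
Qed.

Lemma ksd_loss_lipschitz_grad (Lf := ksd_loss P z xi k (grad f) mu sigma) :
  (forall phi, differentiable Lf phi) /\
  (forall phi1 phi2, enorm (grad Lf phi1 - grad Lf phi2)
    <= smoothness_const * B ^+ 2 * G ^+ 2 * dz%:R * ln d%:R
       * (Num.max 1 L ^+ 3 + L * d%:R + M ^+ 2 + C) * enorm (phi1 - phi2)).
Proof.
have -> : smoothness_const * B ^+ 2 * G ^+ 2 * dz%:R * ln d%:R
    * (Num.max 1 L ^+ 3 + L * d%:R + M ^+ 2 + C) = 6 * Q.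
  rewrite /smoothness_const /Q /scaleA /scaleF /W -/alpha -/beta; ring.
apply: (Rintegral_lipschitz_grad h_integrable h_diff h_rem Lam_mean).
apply: mulr_ge0 (sqr_ge0 _) (ltW _).
apply: mulr_gt0 (mulr_gt0 alpha_gt0 scaleA_gt0) _.
exact: mulr_gt0 beta_gt0 (ltr_wpDr W_ge0 scaleF_gt0).
Qed.

End Loss.

Theorem theorem2 (R : realType) (c1 c0 : R) (hc1 : 0 < c1) (hc0 : 0 < c0) :
  exists K : R,
  forall (d dz m : nat) (hd : (2 <= d)%N) (hdz : (1 <= dz)%N)
    (* probability space carrying the mixing variable z and the noise xi *)
    (dO : measure_display) (Omega : measurableType dO) (P : probability Omega R)
    (z : Omega -> 'rV[R]_dz) (xi : Omega -> 'rV[R]_d)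
    (* target density, kernel, variational parameters *)
    (p : 'rV[R]_d -> R) (k : 'rV[R]_d -> 'rV[R]_d -> R)
    (mu sigma : 'rV[R]_dz -> 'rV[R]_m -> 'rV[R]_d)
    (B L M G s : R) (xstar : 'rV[R]_d),
  (* z has law q(z); xi ~ N(0, I_d) independent of z *)
  (forall j, measurable_fun setT (fun w => z w ord0 j)) ->
  (forall i, measurable_fun setT (fun w => xi w ord0 i)) ->
  (forall i (A : set R), measurable A ->
      P ((fun w => xi w ord0 i) @^-1` A) = normal_prob 0 1 A) ->
  (forall (A : 'I_dz -> set R) (Bs : 'I_d -> set R),
      (forall j, measurable (A j)) -> (forall i, measurable (Bs i)) ->
      P ([set w | forall j, A j (z w ord0 j)] `&` [set w | forall i, Bs i (xi w ord0 i)])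
      = (P [set w | forall j, A j (z w ord0 j)] *
         \prod_(i < d) P ((fun w => xi w ord0 i) @^-1` Bs i))%E) ->
  (* measurability of mu(z;phi), sigma(z;phi) as random variables *)
  (forall phi i, measurable_fun setT (fun w => mu (z w) phi ord0 i)) ->
  (forall phi i, measurable_fun setT (fun w => sigma (z w) phi ord0 i)) ->
  (* p is a positive density (only its score matters) *)
  (forall x, 0 < p x) ->
  (* k is a continuous p.s.d. kernel, differentiable as needed for (A1) *)
  cont_psd_kernel k ->
  (forall y x, differentiable (k ^~ y) x) ->
  (forall y u x, differentiable ('D_u (k ^~ y)) x) ->
  (forall x u y, differentiable (fun y' => 'D_u (k ^~ y') x) y) ->
  (* (A1) *)
  (forall x y (u v : 'rV[R]_d), enorm u <= 1 -> enorm v <= 1 ->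
     [/\ k x y <= B ^+ 2,
         `|'D_u (k ^~ y) x| <= B ^+ 2,
         `|'D_v ('D_u (k ^~ y)) x| <= B ^+ 2
       & `|'D_v (fun y' => 'D_u (k ^~ y') x) y| <= B ^+ 2]) ->
  (* (A2) *)
  0 < L ->
  C3 (fun x => ln (p x)) ->
  (forall x (u v w : 'rV[R]_d), enorm u <= 1 -> enorm v <= 1 -> enorm w <= 1 ->
     `|'D_u ('D_v (fun y => ln (p y))) x| <= L /\
     `|'D_u ('D_v ('D_w (fun y => ln (p y)))) x| <= M) ->
  (* (A3) *)
  1 <= G ->
  (forall zz phi, differentiable (mu zz) phi) ->
  (forall zz v phi, differentiable ('D_v (mu zz)) phi) ->
  (forall zz phi, differentiable (sigma zz) phi) ->
  (forall zz v phi, differentiable ('D_v (sigma zz)) phi) ->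
  (forall zz phi (v w : 'rV[R]_m), enorm v <= 1 -> enorm w <= 1 ->
     [/\ enorm ('D_v (mu zz) phi) <= G * (1 + enorm zz),
         enorm ('D_w ('D_v (mu zz)) phi) <= G * (1 + enorm zz),
         enorm ('D_v (sigma zz) phi) <= G * (1 + enorm zz)
       & enorm ('D_w ('D_v (sigma zz)) phi) <= G * (1 + enorm zz)]) ->
  (forall zz phi i, 1 / Num.sqrt L <= sigma zz phi ord0 i) ->
  (* (A4) *)
  (\int[P]_w ((enorm (z w)) ^+ 4)%:E <= (c1 * (dz%:R) ^+ 2)%:E)%E ->
  (forall phi,
     (\int[P]_w ((enorm (xsample mu sigma phi (z w) (xi w))) ^+ 4)%:E
        <= (s ^+ 4)%:E)%E) ->
  (* conclusion: L(phi) is L_phi-smooth *)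
  let sp := grad (fun x => ln (p x)) in
  let Lf := ksd_loss P z xi k sp mu sigma in
  let C := Num.sqrt (c0 * (L ^+ 4 * (s ^+ 4 + enorm xstar ^+ 4)
                           + enorm (sp xstar) ^+ 4)) in
  let Lphi := K * B ^+ 2 * G ^+ 2 * dz%:R * ln (d%:R : R) *
              ((Num.max 1 L) ^+ 3 + L * d%:R + M ^+ 2 + C) in
  (forall phi, differentiable Lf phi) /\
  (forall phi1 phi2, enorm (grad Lf phi1 - grad Lf phi2) <= Lphi * enorm (phi1 - phi2)).
Proof.
exists (smoothness_const c1 c0).
move=> d dz m hd hdz dO Omega P z xi p k mu sigma B L M G s xstar.
move=> mz mxi law_xi indep mmu msigma _ k_psd dk d11k d12k k_le L_gt0 f_C3 f_le.
move=> G_ge1 dmu ddmu dsigma ddsigma musigma_le sigma_ge z_moment x_moment.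
have mu_C2 y : C2_bounded (mu y) (G * (1 + enorm y)).
  by split=> // phi v w v1 w1; have [] := musigma_le y phi v w v1 w1.
have sigma_C2 y : C2_bounded (sigma y) (G * (1 + enorm y)).
  by split=> // phi v w v1 w1; have [] := musigma_le y phi v w v1 w1.
apply: (ksd_loss_lipschitz_grad (M := M) xstar hc1 hc0 hd hdz mz mxi law_xi
  (rectangles_indep_prod indep) mmu msigma k_psd _ L_gt0 _ G_ge1 mu_C2 sigma_C2
  _ z_moment x_moment).
- by split.
- by split.
- by move=> y phi i; rewrite -div1r.
Qed.
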